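(* Let $p>1$ and let $s,q,V:\mathbb{R}^3\to(0,\infty)$ be radially symmetric $C^2$-functions. Put $T=2\pi\sqrt{s(0)/q(0)}$. Assume: (H1)' $T\sqrt{q(x)/s(x)}>2\pi$ for all $x\in\mathbb{R}^3\setminus\{0\}$; (H2) $\bigl|2\pi-T\sqrt{q(x)/s(x)}\bigr|^{\frac{1}{p-1}}\to 0$ in the $C^2$-sense as $x\to 0$; (H3) $\sup_{x\in\mathbb{R}^3}\bigl|2\pi-T\sqrt{q(x)/s(x)}\bigr|\,e^{\delta(p-1)|x|}<\infty$ for some $\delta>0$; (H4) $\sup_{x\in\mathbb{R}^3} q(x)/V(x)<\infty$. Then there exists a classical ($C^2$) solution $U:\mathbb{R}^3\times\mathbb{R}\to\mathbb{R}^3$ of $$s(x)\partial_t^2U+\nabla\times\nabla\times U+q(x)U-V(x)|U|^{p-1}U=0\quad\text{for }(x,t)\in\mathbb{R}^3\times\mathbb{R},$$ which is $T$-periodic in $t$ and satisfies $\sup_{\mathbb{R}^3\times\mathbb{R}}|U(x,t)|e^{\delta|x|}<\infty$. Moreover, for every radially symmetric $C^2$-function $a:\mathbb{R}^3\to\mathbb{R}$, the function $U_a(x,t)=U(x,t+a(x))$ is also such a $T$-periodic breather solution of the same equation.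
   Context: A function $f:\mathbb{R}^3\to\mathbb{R}$ is radially symmetric if $f(x)$ depends only on $|x|$. For $f:\mathbb{R}^3\to\mathbb{R}$ one says $f(x)\to 0$ in the $C^2$-sense as $x\to 0$ if $f(x)\to0$, $\nabla f(x)\to 0$ and $D^2f(x)\to 0$ as $x\to 0$. A breather is a time-periodic, spatially localized real-valued solution. *)

(* Defs.v *)
From mathcomp Require Import all_boot all_order all_algebra.
From mathcomp Require Import all_classical all_reals all_analysis.
Set Implicit Arguments. Unset Strict Implicit. Unset Printing Implicit Defensive.
Import Order.TTheory GRing.Theory Num.Theory numFieldNormedType.Exports.
Local Open Scope ring_scope.
Local Open Scope classical_set_scope.

Definition e3 {R : realType} (i : 'I_3) : 'rV[R]_3 := delta_mx 0 i.

(* Euclidean norm |x| on R^3 (the library norm on 'rV is the max-norm) *)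
Definition enorm {R : realType} (x : 'rV[R]_3) : R :=
  Num.sqrt (\sum_(i < 3) x 0 i ^+ 2).

Definition radial {R : realType} {T : Type} (f : 'rV[R]_3 -> T) : Prop :=
  forall x y, enorm x = enorm y -> f x = f y.

Definition C2 {R : realType} {V W : normedModType R} {n : nat}
  (dir : 'I_n -> V) (f : V -> W) : Prop :=
  continuous f /\
  (forall i x, derivable f x (dir i)) /\
  (forall i, continuous ('D_(dir i) f)) /\
  (forall i j x, derivable ('D_(dir j) f) x (dir i)) /\
  (forall i j, continuous ('D_(dir i) ('D_(dir j) f))).

Definition st_dir {R : realType} (i : 'I_4) : 'rV[R]_3 * R :=
  if (i < 3)%N then (e3 (inord i), 0) else (0, 1).

Definition dt {R : realType} : 'rV[R]_3 * R := (0, 1).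

Definition pdx {R : realType} (j : 'I_3) (f : 'rV[R]_3 -> R) : 'rV[R]_3 -> R :=
  'D_(e3 j) f.

Definition curl {R : realType} (F : 'rV[R]_3 -> 'rV[R]_3) : 'rV[R]_3 -> 'rV[R]_3 :=
  fun x => \row_(i < 3)
    (let i1 : 'I_3 := inord ((i + 1) %% 3) in
     let i2 : 'I_3 := inord ((i + 2) %% 3) in
     pdx i1 (fun y => F y 0 i2) x - pdx i2 (fun y => F y 0 i1) x).

Definition curlcurl_lhs {R : realType} (s q V : 'rV[R]_3 -> R) (p : R)
  (U : 'rV[R]_3 * R -> 'rV[R]_3) (x : 'rV[R]_3) (t : R) : 'rV[R]_3 :=
  s x *: ('D_dt ('D_dt U) (x, t))
  + curl (curl (fun y => U (y, t))) x
  + q x *: U (x, t)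
  - (V x * (enorm (U (x, t))) `^ (p - 1)) *: U (x, t).

Definition periodic_breather {R : realType} (s q V : 'rV[R]_3 -> R) (p T delta : R)
  (U : 'rV[R]_3 * R -> 'rV[R]_3) : Prop :=
  C2 st_dir U /\
  (forall x t, curlcurl_lhs s q V p U x t = 0) /\
  (forall x t, U (x, t + T) = U (x, t)) /\
  (exists M : R, forall x t, enorm (U (x, t)) * expR (delta * enorm x) <= M).

(* Main.v *)
Require Import Defs.
From mathcomp Require Import all_boot all_order all_algebra.
From mathcomp Require Import all_classical all_reals all_analysis.
From mathcomp Require Import ring lra.
Set Implicit Arguments. Unset Strict Implicit. Unset Printing Implicit Defensive.
Import Order.TTheory GRing.Theory Num.Theory numFieldNormedType.Exports.
Local Open Scope ring_scope.
Local Open Scope classical_set_scope.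

(** We look for curl-free fields [U(x,t) = (x / |x|) Y(|x|, t)]. The equation then
    decouples into the oscillator [s Y_tt + q Y = V |Y|^(p-1) Y] for each [r = |x|].
    After rescaling, its periodic orbits are [w = sin theta] with
    [theta' = sqrt (1 - eps K theta)] and
    [K theta = 2 / (p+1) * (1 - |sin theta|^(p+1)) / cos^2 theta], a C^1 function with
    values in (0, 1]. With [eps = 1 - exp (- eta)] the time map
    [P(theta, eta) = theta + (1 - exp (- eta)) N(theta, eta)] is C^2, the period
    [P(2 pi, .)] increases from [2 pi] to infinity, and the orbit at radius [r] is the one
    whose rescaled period is [T sqrt (q/s)(r)]; the implicit function theorem makes it C^2
    in [(r, t)]. Since period minus [2 pi] equals [eps] times a positive C^2 function, the
    amplitude factors as [Y = g(r) H(r, t)] with [H] of class C^2 up to [r = 0] and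
    [g = |2 pi - T sqrt (q/s)|^(1/(p-1))]. So (H2) yields C^2 smoothness of [U] at the
    origin and (H3) its exponential decay. *)

(** * Functions of class C^k of two real variables *)

(** In rescaled time the oscillator reads [y'' + y = eps |y|^(p-1) y]. For an orbit turning at
    [y = 1] the energy identity is [y'^2 = 1 - y^2 - 2 eps / (p+1) * (1 - |y|^(p+1))]; putting
    [y = sin theta] and dividing by [cos^2 theta] gives [theta'^2 = 1 - eps K]. At [eps = 1] the
    turning point becomes an equilibrium, hence the unbounded period. Regularity dictates the rest.
    At [r = 0] the period is exactly [2 pi], so [eps = 0]; since [1 - exp (- eta)] also makes sense
    for negative [eta], this is an interior point for the implicit function argument. [K] enters
    only as a C^1 function: the missing order in theta is regained by integrating in theta, and the
    dependence on [eta] is smooth before [K] is substituted. The root [(period - 2 pi)^(1/(p-1))]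
    may fail to be smooth at [r = 0], so it stays a separate factor [g] instead of being absorbed
    into [H]. (H4) bounds [H], which lets the decay of [g] pass to [U]. Each oscillator is
    autonomous, so a radial shift of time merely replaces [H(r, t)] by [H(r, t + a(r))]. *)

Section TwoVariables.
Context {R : realType}.
Implicit Types (f g : R -> R -> R) (D : set (R * R)).

Lemma nbhs_square (x y : R) (P : set (R * R)) :
  nbhs (x, y) P -> exists2 e, 0 < e &
    forall x' y', `|x' - x| < e -> `|y' - y| < e -> P (x', y').
Proof.
case/nbhs_ballP => e /= e0 eP; exists e => // x' y' hx hy; apply: eP.
by split; rewrite /= -ball_normE /= distrC.
Qed.

Lemma near_dist (x e : R) : 0 < e -> nbhs x [set y | `|y - x| < e].
Proof.
by move=> e0; apply/nbhs_ballP; exists e => //= y; rewrite -ball_normE /= distrC.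
Qed.

Lemma near_square (x y e : R) : 0 < e ->
  nbhs (x, y) [set z : R * R | `|z.1 - x| < e /\ `|z.2 - y| < e].
Proof.
move=> e0; apply/nbhs_ballP; exists e => //= z [].
by rewrite -!ball_normE /= !(distrC _ z.1) !(distrC _ z.2).
Qed.

Lemma mvt_center (f f' : R -> R) (x0 x : R) :
  (forall z, `|z - x0| <= `|x - x0| -> is_derive z 1 f (f' z)) ->
  exists2 c, `|c - x0| <= `|x - x0| & f x - f x0 = f' c * (x - x0).
Proof.
move=> df.
have oo_cc (a b z : R) : z \in `]a, b[%R -> z \in `[a, b]%R.
  by rewrite !in_itv /= => /andP[/ltW -> /ltW ->].
have dcont a b : (forall z, z \in `[a, b]%R -> `|z - x0| <= `|x - x0|) ->
    {within `[a, b], continuous f}.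
  move=> H; apply: derivable_within_continuous => z /H/df hz.
  exact: (@ex_derive _ _ _ _ _ _ _ hz).
have [xx|xx|->] := ltgtP x0 x; last by exists x => //; rewrite !subrr mulr0.
- have H z : z \in `[x0, x]%R -> `|z - x0| <= `|x - x0|.
    by rewrite in_itv /= => /andP[a b]; rewrite !ger0_norm ?subr_ge0 ?lerB// ltW.
  have [c cI cE] := MVT xx (fun z zI => df z (H z (oo_cc _ _ _ zI))) (dcont _ _ H).
  by exists c => //; apply: H; exact: oo_cc cI.
- have H z : z \in `[x, x0]%R -> `|z - x0| <= `|x - x0|.
    rewrite in_itv /= => /andP[a b].
    by rewrite !ler0_norm ?subr_le0 ?lerN2 ?lerB// ltW.
  have [c cI cE] := MVT xx (fun z zI => df z (H z (oo_cc _ _ _ zI))) (dcont _ _ H).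
  exists c; first by apply: H; exact: oo_cc cI.
  by rewrite -opprB cE -mulrN opprB.
Qed.

(** The increment is split through [f x0 y]: the y-slope is taken on the line [x = x0], and joint
    continuity of [f1] controls the x-slope. The two slopes play the role of a total differential,
    so that chain and implicit rules become algebra. *)
Lemma caratheodory2 f (f1 : R -> R -> R) (x0 y0 f2 : R) :
  nbhs (x0, y0) [set z : R * R | is_derive z.1 1 (f^~ z.2) (f1 z.1 z.2)] ->
  {for (x0, y0), continuous (fun z : R * R => f1 z.1 z.2)} ->
  is_derive y0 1 (f x0) f2 ->
  exists q1 : R -> R -> R, exists q2 : R -> R,
    [/\ forall x y, f x y - f x0 y0 = q1 x y * (x - x0) + q2 y * (y - y0),
        {for (x0, y0), continuous (fun z : R * R => q1 z.1 z.2)},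
        {for y0, continuous q2}, q1 x0 y0 = f1 x0 y0 & q2 y0 = f2].
Proof.
move=> df cf1 /is_derive1_caratheodory[q2 [q2E q2c q20]].
(* On the line [x = x0] the slope is multiplied by zero, so a constant value serves there; off it,
   continuity at the base point comes from the mean value theorem. *)
pose q1 x y := if x == x0 then f1 x0 y0 else (f x y - f x0 y) / (x - x0).
have q10 : q1 x0 y0 = f1 x0 y0 by rewrite /q1 eqxx.
exists q1, q2; split=> //.
- move=> x y; rewrite -q2E /q1; case: eqVneq => [->|xx0].
    by rewrite subrr mulr0 add0r.
  by rewrite divfK ?subr_eq0// addrA subrK.
- apply/cvgrPdist_lt => e e0 /=; rewrite q10.
  have /cvgrPdist_lt/(_ e e0) := cf1.
  have [d1 d10 hd1] := nbhs_square df.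
  move=> /nbhs_square[d2 d20 hd2].
  have d0 : 0 < Num.min d1 d2 by rewrite lt_min d10.
  near=> z; have [zx zy] : `|z.1 - x0| < Num.min d1 d2 /\ `|z.2 - y0| < Num.min d1 d2.
    by near: z; apply: near_square.
  move: zx zy; rewrite !lt_min => /andP[zx1 zx2] /andP[zy1 zy2].
  rewrite /q1; case: eqVneq => [_|zx0]; first by rewrite subrr normr0.
  have [|c cz ->] := @mvt_center (f^~ z.2) (f1^~ z.2) x0 z.1.
    move=> w wz; apply: (hd1 w z.2) => //; exact: le_lt_trans zx1.
  rewrite mulfK ?subr_eq0//; apply: (hd2 c z.2) => //; exact: le_lt_trans zx2.
Unshelve. all: by end_near. Qed.

Definition pd1 f (x y : R) : R := 'D_1 (f^~ y) x.
Definition pd2 f (x y : R) : R := 'D_1 (f x) y.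

(** Both partial derivatives must have the previous class, so mixed derivatives in every order are
    covered. Continuity is asked at the last order only; [Ck1_continuous] recovers it below.
    Derivatives are taken in the full plane, which is why domains are open later. *)
Fixpoint Ck (n : nat) D f : Prop :=
  if n is m.+1 then
    [/\ forall x y, D (x, y) -> derivable (f^~ y) x 1 /\ derivable (f x) y 1,
        Ck m D (pd1 f) & Ck m D (pd2 f)]
  else forall x y, D (x, y) -> {for (x, y), continuous (fun z : R * R => f z.1 z.2)}.

Lemma Ck0P D f : Ck 0 D f <->
  forall x y, D (x, y) -> {for (x, y), continuous (fun z : R * R => f z.1 z.2)}.
Proof. by split. Qed.

Lemma CkSP n D f : Ck n.+1 D f <->
  [/\ forall x y, D (x, y) -> derivable (f^~ y) x 1 /\ derivable (f x) y 1,
      Ck n D (pd1 f) & Ck n D (pd2 f)].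
Proof. by split. Qed.

Opaque Ck.

Lemma Ck_pd1 n D f : Ck n.+1 D f -> Ck n D (pd1 f).
Proof. by move=> /CkSP[]. Qed.

Lemma Ck_pd2 n D f : Ck n.+1 D f -> Ck n D (pd2 f).
Proof. by move=> /CkSP[]. Qed.

Lemma Ck0_continuous D f x y : Ck 0 D f -> D (x, y) ->
  {for (x, y), continuous (fun z : R * R => f z.1 z.2)}.
Proof. by move=> /Ck0P; apply. Qed.

Lemma is_derive_pd1 n D f x y : Ck n.+1 D f -> D (x, y) ->
  is_derive x 1 (f^~ y) (pd1 f x y).
Proof. by move=> /CkSP[df _ _] /df[? _]; apply: derivableP. Qed.

Lemma is_derive_pd2 n D f x y : Ck n.+1 D f -> D (x, y) ->
  is_derive y 1 (f x) (pd2 f x y).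
Proof. by move=> /CkSP[df _ _] /df[_ ?]; apply: derivableP. Qed.

Lemma Ck1_caratheodory D f x0 y0 : open D -> D (x0, y0) -> Ck 1 D f ->
  exists q1 : R -> R -> R, exists q2 : R -> R,
    [/\ forall x y, f x y - f x0 y0 = q1 x y * (x - x0) + q2 y * (y - y0),
        {for (x0, y0), continuous (fun z : R * R => q1 z.1 z.2)},
        {for y0, continuous q2}, q1 x0 y0 = pd1 f x0 y0 & q2 y0 = pd2 f x0 y0].
Proof.
move=> oD Dxy Cf; apply: caratheodory2; last exact: is_derive_pd2 Cf _.
- have := open_nbhs_nbhs (conj oD Dxy); apply: filterS => -[x y] /= Dz.
  exact: is_derive_pd1 Cf Dz.
- exact: Ck0_continuous (Ck_pd1 Cf) Dxy.
Qed.

Lemma near_line1 D x y : open D -> D (x, y) -> \forall x' \near x, D (x', y).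
Proof.
move=> oD Dxy; have [e e0 he] := nbhs_square (open_nbhs_nbhs (conj oD Dxy)).
apply/nbhs_ballP; exists e => //= x'; rewrite -ball_normE /= distrC => h.
by apply: he => //; rewrite subrr normr0.
Qed.

Lemma near_line2 D x y : open D -> D (x, y) -> \forall y' \near y, D (x, y').
Proof.
move=> oD Dxy; have [e e0 he] := nbhs_square (open_nbhs_nbhs (conj oD Dxy)).
apply/nbhs_ballP; exists e => //= y'; rewrite -ball_normE /= distrC => h.
by apply: he => //; rewrite subrr normr0.
Qed.

Lemma eq_Ck n D f g : open D -> (forall x y, D (x, y) -> f x y = g x y) ->
  Ck n D f -> Ck n D g.
Proof.
move=> oD; elim: n f g => [|n IH] f g fg.
  move=> /Ck0P Cf; apply/Ck0P => x y Dxy; rewrite /prop_for /continuous_at /= -fg //.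
  apply: cvg_trans (Cf x y Dxy); apply: near_eq_cvg; have := open_nbhs_nbhs (conj oD Dxy).
  by apply: filterS => -[x' y'] /= Dz; rewrite fg.
have e1 x y : D (x, y) -> {near x, (f^~ y) =1 (g^~ y)}.
  by move=> Dxy; apply: filterS (near_line1 oD Dxy) => x' /fg.
have e2 x y : D (x, y) -> {near y, (f x) =1 (g x)}.
  by move=> Dxy; apply: filterS (near_line2 oD Dxy) => y' /fg.
move=> /CkSP[df C1 C2]; apply/CkSP; split.
- move=> x y Dxy; have [d1 d2] := df x y Dxy; split.
    exact: near_eq_derivable (e1 _ _ Dxy) d1.
  exact: near_eq_derivable (e2 _ _ Dxy) d2.
- by apply: IH C1 => x y Dxy; apply: near_eq_derive; apply: e1.
- by apply: IH C2 => x y Dxy; apply: near_eq_derive; apply: e2.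
Qed.

Lemma CkS_intro n D f f1 f2 : open D ->
  (forall x y, D (x, y) -> is_derive x 1 (f^~ y) (f1 x y)) ->
  (forall x y, D (x, y) -> is_derive y 1 (f x) (f2 x y)) ->
  Ck n D f1 -> Ck n D f2 -> Ck n.+1 D f.
Proof.
move=> oD d1 d2 C1 C2; apply/CkSP; split.
- move=> x y Dxy; split; first exact: (@ex_derive _ _ _ _ _ _ _ (d1 _ _ Dxy)).
  exact: (@ex_derive _ _ _ _ _ _ _ (d2 _ _ Dxy)).
- apply: eq_Ck C1 => // x y Dxy; symmetry.
  exact: (@derive_val _ _ _ _ _ _ _ (d1 _ _ Dxy)).
- apply: eq_Ck C2 => // x y Dxy; symmetry.
  exact: (@derive_val _ _ _ _ _ _ _ (d2 _ _ Dxy)).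
Qed.

Lemma Ck1_continuous D f : open D -> Ck 1 D f -> Ck 0 D f.
Proof.
move=> oD Cf; apply/Ck0P => x0 y0 Dxy.
have [q1 [q2 [fE c1 c2 _ _]]] := Ck1_caratheodory oD Dxy Cf.
have -> : (fun z : R * R => f z.1 z.2) =
  (fun z => f x0 y0 + (q1 z.1 z.2 * (z.1 - x0) + q2 z.2 * (z.2 - y0))).
  by apply/funext => z; rewrite -fE addrC subrK.
rewrite /prop_for /continuous_at /=; apply: cvgD; first exact: cvg_cst.
have cz1 : z.1 - x0 @[z --> (x0, y0)] --> x0 - x0.
  by apply: cvgB; [apply: cvg_fst|apply: cvg_cst].
have cz2 : z.2 - y0 @[z --> (x0, y0)] --> y0 - y0.
  by apply: cvgB; [apply: cvg_snd|apply: cvg_cst].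
apply: cvgD; apply: cvgM => //.
by apply: (cvg_comp (fun z : R * R => z.2) q2); [apply: cvg_snd|exact: c2].
Qed.

Lemma CkS n D f : open D -> Ck n.+1 D f -> Ck n D f.
Proof.
move=> oD; elim: n f => [|n IH] f; first exact: Ck1_continuous.
move=> /CkSP[df C1 C2]; apply/CkSP; split; first exact: df.
  exact: IH C1.
exact: IH C2.
Qed.

Lemma Ck_le m n D f : open D -> (m <= n)%N -> Ck n D f -> Ck m D f.
Proof.
move=> oD; elim: n => [|n IH]; first by rewrite leqn0 => /eqP->.
rewrite leq_eqVlt ltnS => /orP[/eqP->//|mn Cf]; apply: IH => //.
exact: CkS.
Qed.

(** Allows different formulas for one function on different open pieces of [D]. *)
Lemma Ck_local n D f : (forall x y, D (x, y) ->
  exists2 D', open D' /\ D' (x, y) & Ck n D' f) -> Ck n D f.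
Proof.
elim: n f => [|n IH] f H.
  by apply/Ck0P => x y /H[D' [_ D'xy]] /Ck0P/(_ _ _ D'xy).
apply/CkSP; split.
- by move=> x y /H[D' [_ D'xy]] /CkSP[/(_ _ _ D'xy)].
- by apply: IH => x y /H[D' oD' /Ck_pd1 ?]; exists D'.
- by apply: IH => x y /H[D' oD' /Ck_pd2 ?]; exists D'.
Qed.

Lemma Ck_sub n D D' f : D' `<=` D -> Ck n D f -> Ck n D' f.
Proof.
move=> DD; elim: n f => [|n IH] f; first by move=> /Ck0P H; apply/Ck0P => x y /DD; exact: H.
move=> /CkSP[df C1 C2]; apply/CkSP; split; [by move=> x y /DD/df| |]; exact: IH.
Qed.

Lemma Ck_cst n D c : open D -> Ck n D (fun _ _ => c).
Proof.
move=> oD; elim: n c => [|n IH] c; first by apply/Ck0P => x y _; exact: cvg_cst.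
apply: (@CkS_intro n D _ (fun _ _ => 0) (fun _ _ => 0)) => //;
  by move=> x y _; exact: is_derive_cst.
Qed.

Lemma Ck_fst n D : open D -> Ck n D (fun x _ => x).
Proof.
move=> oD; case: n => [|n]; first by apply/Ck0P => x y _; exact: cvg_fst.
apply: (@CkS_intro n D _ (fun _ _ => 1) (fun _ _ => 0)) => //; exact: Ck_cst.
Qed.

Lemma Ck_snd n D : open D -> Ck n D (fun _ y => y).
Proof.
move=> oD; case: n => [|n]; first by apply/Ck0P => x y _; exact: cvg_snd.
apply: (@CkS_intro n D _ (fun _ _ => 0) (fun _ _ => 1)) => //; try exact: Ck_cst.
by move=> x y _; exact: is_derive_cst.
Qed.

Lemma CkD n D f g : open D -> Ck n D f -> Ck n D g -> Ck n D (fun x y => f x y + g x y).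
Proof.
move=> oD; elim: n f g => [|n IH] f g Cf Cg.
  by apply/Ck0P => x y Dxy; apply: cvgD; exact: Ck0_continuous Dxy.
apply: (@CkS_intro n D _ (fun x y => pd1 f x y + pd1 g x y)
   (fun x y => pd2 f x y + pd2 g x y)) => //.
- by move=> x y Dxy; exact: is_deriveD (is_derive_pd1 Cf Dxy) (is_derive_pd1 Cg Dxy).
- by move=> x y Dxy; exact: is_deriveD (is_derive_pd2 Cf Dxy) (is_derive_pd2 Cg Dxy).
- exact: IH (Ck_pd1 Cf) (Ck_pd1 Cg).
- exact: IH (Ck_pd2 Cf) (Ck_pd2 Cg).
Qed.

Lemma CkM n D f g : open D -> Ck n D f -> Ck n D g -> Ck n D (fun x y => f x y * g x y).
Proof.
move=> oD; elim: n f g => [|n IH] f g Cf Cg.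
  by apply/Ck0P => x y Dxy; apply: cvgM; exact: Ck0_continuous Dxy.
apply: (@CkS_intro n D _ (fun x y => f x y * pd1 g x y + g x y * pd1 f x y)
   (fun x y => f x y * pd2 g x y + g x y * pd2 f x y)) => //.
- by move=> x y Dxy; exact: is_deriveM (is_derive_pd1 Cf Dxy) (is_derive_pd1 Cg Dxy).
- by move=> x y Dxy; exact: is_deriveM (is_derive_pd2 Cf Dxy) (is_derive_pd2 Cg Dxy).
- exact: CkD oD (IH _ _ (CkS oD Cf) (Ck_pd1 Cg)) (IH _ _ (CkS oD Cg) (Ck_pd1 Cf)).
- exact: CkD oD (IH _ _ (CkS oD Cf) (Ck_pd2 Cg)) (IH _ _ (CkS oD Cg) (Ck_pd2 Cf)).
Qed.

Lemma CkN n D f : open D -> Ck n D f -> Ck n D (fun x y => - f x y).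
Proof.
move=> oD Cf; have := CkM oD (Ck_cst n (- 1) oD) Cf.
by apply: eq_Ck => // x y _; rewrite mulN1r.
Qed.

Lemma CkB n D f g : open D -> Ck n D f -> Ck n D g -> Ck n D (fun x y => f x y - g x y).
Proof. by move=> oD Cf Cg; apply: CkD => //; apply: CkN. Qed.

Lemma is_derive_curve D f (a b : R -> R) (r a' b' : R) :
  open D -> D (a r, b r) -> Ck 1 D f ->
  is_derive r 1 a a' -> is_derive r 1 b b' ->
  is_derive r 1 (fun r => f (a r) (b r)) (pd1 f (a r) (b r) * a' + pd2 f (a r) (b r) * b').
Proof.
move=> oD Dr Cf /is_derive1_caratheodory[ga [gaE gac ga0]].
move=> /is_derive1_caratheodory[gb [gbE gbc gb0]].
have [q1 [q2 [fE c1 c2 q10 q20]]] := Ck1_caratheodory oD Dr Cf.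
apply/is_derive1_caratheodory.
have ca : {for r, continuous a}.
  apply/differentiable_continuous/derivable1_diffP.
  suff h : is_derive r 1 a a' by exact: ex_derive.
  by apply/is_derive1_caratheodory; exists ga.
have cb : {for r, continuous b}.
  apply/differentiable_continuous/derivable1_diffP.
  suff h : is_derive r 1 b b' by exact: ex_derive.
  by apply/is_derive1_caratheodory; exists gb.
exists (fun z => q1 (a z) (b z) * ga z + q2 (b z) * gb z); split.
- by move=> z; rewrite fE gaE gbE mulrDl !mulrA.
- rewrite /prop_for /continuous_at; apply: cvgD; apply: cvgM => //.
    exact: (cvg_comp2 ca cb c1).
  exact: (cvg_comp _ _ cb c2).
- by rewrite q10 q20 ga0 gb0.
Qed.

Lemma Ck_comp n D D' g a b : open D -> open D' ->
  (forall x y, D (x, y) -> D' (a x y, b x y)) ->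
  Ck n D' g -> Ck n D a -> Ck n D b -> Ck n D (fun x y => g (a x y) (b x y)).
Proof.
move=> oD oD' DD'; elim: n g => [|n IH] g Cg Ca Cb.
  apply/Ck0P => x y Dxy.
  have h1 := Ck0_continuous Ca Dxy; have h2 := Ck0_continuous Cb Dxy.
  exact: (cvg_comp2 h1 h2 (Ck0_continuous Cg (DD' _ _ Dxy))).
have Cg1 : Ck 1 D' g by apply: Ck_le Cg.
have IH1 := IH _ (Ck_pd1 Cg) (CkS oD Ca) (CkS oD Cb).
have IH2 := IH _ (Ck_pd2 Cg) (CkS oD Ca) (CkS oD Cb).
have h1 x y (Dxy : D (x, y)) := is_derive_curve (a := a^~ y) (b := b^~ y) oD'
  (DD' _ _ Dxy) Cg1 (is_derive_pd1 Ca Dxy) (is_derive_pd1 Cb Dxy).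
have h2 x y (Dxy : D (x, y)) := is_derive_curve (a := a x) (b := b x) oD'
  (DD' _ _ Dxy) Cg1 (is_derive_pd2 Ca Dxy) (is_derive_pd2 Cb Dxy).
have h3 := CkD oD (CkM oD IH1 (Ck_pd1 Ca)) (CkM oD IH2 (Ck_pd1 Cb)).
have h4 := CkD oD (CkM oD IH1 (Ck_pd2 Ca)) (CkM oD IH2 (Ck_pd2 Cb)).
exact: (CkS_intro oD h1 h2 h3 h4).
Qed.

(** The Caratheodory slopes turn [f (a z) (b z) = c z] into a linear equation for [a z - a r] whose
    coefficient stays nonzero near [r]. This is the differentiability half of the implicit function
    theorem; continuity of the branch [a] is an input, obtained later from monotonicity or from an
    expansion bound. *)
Lemma is_derive_implicit D f (a b c : R -> R) (r b' c' : R) :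
  open D -> D (a r, b r) -> Ck 1 D f -> pd1 f (a r) (b r) != 0 ->
  (forall z, f (a z) (b z) = c z) -> {for r, continuous a} ->
  is_derive r 1 b b' -> is_derive r 1 c c' ->
  is_derive r 1 a ((c' - pd2 f (a r) (b r) * b') / pd1 f (a r) (b r)).
Proof.
move=> oD Dr Cf f10 fE' ca db /is_derive1_caratheodory[gc [gcE gcc gc0]].
have cb : {for r, continuous b}.
  exact/differentiable_continuous/derivable1_diffP/(@ex_derive _ _ _ _ _ _ _ db).
move: db => /is_derive1_caratheodory[gb [gbE gbc gb0]].
have [q1 [q2 [fE c1 c2 q10 q20]]] := Ck1_caratheodory oD Dr Cf.
have cq1 : {for r, continuous (fun z => q1 (a z) (b z))} by exact: (cvg_comp2 ca cb c1).
have cq2 : {for r, continuous (fun z => q2 (b z))} by exact: (cvg_comp _ _ cb c2).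
pose h z := (gc z - q2 (b z) * gb z) / q1 (a z) (b z).
have ch : {for r, continuous h}.
  apply: cvgM; first by apply: cvgB => //; apply: cvgM.
  by apply: cvgV => //; rewrite q10.
rewrite -q10 -q20 -gb0 -gc0 -/(h r); move: f10; rewrite -q10 => f10.
apply/is_derive1_caratheodory.
(* Where the coefficient vanishes the plain difference quotient is used, so that the factorisation
   holds for every [z]; near [r] only [h] is seen. *)
exists (fun z => if q1 (a z) (b z) == 0 then (a z - a r) / (z - r) else h z); split.
- move=> z; case: eqVneq => [q0|q0].
    have [->|zr] := eqVneq z r; first by rewrite !subrr mulr0.
    by rewrite divfK ?subr_eq0.
  have := fE (a z) (b z); rewrite !fE' gcE gbE mulrA => E.
  by rewrite /h mulrAC mulrBl E addrK mulrAC mulfV// mul1r.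
- rewrite /prop_for /continuous_at /= (negPf f10).
  apply: cvg_trans ch; apply: near_eq_cvg.
  have := cq1 [set z | z != 0]; rewrite /= => H.
  near=> z.
  have -> // : (q1 (a z) (b z) == 0) = false.
  apply/negbTE; near: z; apply: H.
  by apply: open_nbhs_nbhs; split=> //; apply: open_neq.
- by rewrite (negPf f10).
Unshelve. all: by end_near. Qed.

End TwoVariables.

(* [Ck] unfolds to a product, which [done] would try to apply to every goal. *)
#[global] Opaque Ck.

(** * Elementary functions and parametric primitives *)

Section Elementary.
Context {R : realType}.
Implicit Types (f g : R -> R -> R) (D : set (R * R)).

Lemma open_Ck0_gt0 f : Ck 0 setT f -> open [set z : R * R | 0 < f z.1 z.2].
Proof.
move=> cf; apply: (@open_comp _ _ (fun z : R * R => f z.1 z.2) [set x | 0 < x]) => //.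
by case=> x y _; exact: Ck0_continuous cf I.
Qed.

Definition right_half : set (R * R) := [set z | 0 < z.1].

Lemma open_right_half : open right_half.
Proof. by apply: (@open_Ck0_gt0 (fun x _ => x)); apply: Ck_fst; exact: openT. Qed.

Lemma Ck_cst_snd n D (h h' : R -> R) : open D ->
  (forall x y, D (x, y) -> is_derive x 1 h (h' x)) ->
  Ck n D (fun x _ => h' x) -> Ck n.+1 D (fun x _ => h x).
Proof.
move=> oD dh Ch; apply: (@CkS_intro _ n D _ (fun x _ => h' x) (fun _ _ => 0)) => //.
exact: Ck_cst.
Qed.

Lemma Ck0_1d D (h : R -> R) : (forall x y, D (x, y) -> {for x, continuous h}) ->
  Ck 0 D (fun x _ => h x).
Proof.
move=> ch; apply/Ck0P => x y Dxy; apply: (cvg_comp (fun z : R * R => z.1) h); first exact: cvg_fst.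
exact: ch Dxy.
Qed.

Lemma Ck_expR1 n D : open D -> Ck n D (fun x _ => expR x).
Proof.
move=> oD; elim: n => [|n IH].
  by apply: Ck0_1d => x y _; exact: continuous_expR.
by apply: Ck_cst_snd IH => // x y _; exact: is_derive_expR.
Qed.

Lemma Ck_trig n D : open D ->
  Ck n D (fun x _ => sin x) /\ Ck n D (fun x _ => cos x).
Proof.
move=> oD; elim: n => [|n [Cs Cc]].
  by split; apply: Ck0_1d => x y _; [exact: continuous_sin|exact: continuous_cos].
split.
  by apply: (Ck_cst_snd (h' := cos)) => // x y _; exact: is_derive_sin.
by apply: (Ck_cst_snd (h' := fun x => - sin x)) => //; exact: CkN.
Qed.

Lemma Ck_powR1 n (a : R) : Ck n right_half (fun x _ => x `^ a).
Proof.
elim: n a => [|n IH] a.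
  apply: Ck0_1d => x y; rewrite /right_half /= => x0.
  apply/differentiable_continuous/derivable1_diffP.
  have h := @is_derive1_powR R a x x0; exact: ex_derive.
apply: (Ck_cst_snd open_right_half (fun x y => @is_derive1_powR R a x)).
by apply: CkM (IH _); [|apply: Ck_cst]; exact: open_right_half.
Qed.

Lemma Ck_ln1 n : Ck n right_half (fun x _ => ln x).
Proof.
case: n => [|n].
  by apply: Ck0_1d => x y; rewrite /right_half /= => x0; exact: continuous_ln.
apply: (Ck_cst_snd open_right_half (fun x y => @is_derive1_ln R x)).
apply: eq_Ck (Ck_powR1 n (- 1)); first exact: open_right_half.
by move=> x y; rewrite /right_half /= => x0; rewrite powR_inv1 ?ltW.
Qed.

Lemma Ck_comp1 n D D' (h : R -> R) f : open D -> open D' ->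
  (forall x y, D (x, y) -> D' (f x y, 0)) ->
  Ck n D' (fun x _ => h x) -> Ck n D f -> Ck n D (fun x y => h (f x y)).
Proof.
move=> oD oD' DD' Ch Cf.
exact: (@Ck_comp _ n D D' (fun x _ => h x) f (fun _ _ => 0) oD oD' DD' Ch Cf (Ck_cst n 0 oD)).
Qed.

Lemma Ck_expR n D f : open D -> Ck n D f -> Ck n D (fun x y => expR (f x y)).
Proof.
move=> oD; apply: (@Ck_comp1 n D setT) => //; first exact: openT.
by apply: Ck_expR1; exact: openT.
Qed.

Lemma Ck_sin n D f : open D -> Ck n D f -> Ck n D (fun x y => sin (f x y)).
Proof.
move=> oD; apply: (@Ck_comp1 n D setT) => //; first exact: openT.
by apply: (Ck_trig n _).1; exact: openT.
Qed.

Lemma Ck_cos n D f : open D -> Ck n D f -> Ck n D (fun x y => cos (f x y)).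
Proof.
move=> oD; apply: (@Ck_comp1 n D setT) => //; first exact: openT.
by apply: (Ck_trig n _).2; exact: openT.
Qed.

Lemma Ck_powR n D f (a : R) : open D -> (forall x y, D (x, y) -> 0 < f x y) ->
  Ck n D f -> Ck n D (fun x y => f x y `^ a).
Proof.
move=> oD f0; apply: (@Ck_comp1 n D right_half (fun x => x `^ a)) => //.
  exact: open_right_half.
exact: Ck_powR1.
Qed.

Lemma Ck_ln n D f : open D -> (forall x y, D (x, y) -> 0 < f x y) ->
  Ck n D f -> Ck n D (fun x y => ln (f x y)).
Proof.
move=> oD f0; apply: (@Ck_comp1 n D right_half) => //; first exact: open_right_half.
exact: Ck_ln1.
Qed.

Lemma Ck_inv n D f : open D -> (forall x y, D (x, y) -> 0 < f x y) ->
  Ck n D f -> Ck n D (fun x y => (f x y)^-1).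
Proof.
move=> oD f0 Cf; apply: eq_Ck (Ck_powR (- 1) oD f0 Cf) => // x y Dxy.
by rewrite powR_inv1 // ltW // f0.
Qed.

Lemma Ck_div n D f g : open D -> (forall x y, D (x, y) -> 0 < g x y) ->
  Ck n D f -> Ck n D g -> Ck n D (fun x y => f x y / g x y).
Proof. by move=> oD g0 Cf Cg; apply: CkM => //; apply: Ck_inv. Qed.

Lemma Ck_sqrt n D f : open D -> (forall x y, D (x, y) -> 0 < f x y) ->
  Ck n D f -> Ck n D (fun x y => Num.sqrt (f x y)).
Proof.
move=> oD f0 Cf; apply: eq_Ck (Ck_powR 2^-1 oD f0 Cf) => // x y Dxy.
by rewrite powR12_sqrt // ltW // f0.
Qed.

End Elementary.

(** * Primitives depending on a parameter *)

Section Primitive.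
Context {R : realType}.
Implicit Types (f k : R -> R -> R).

Let right_primitive (h : R -> R) : continuous h ->
  exists2 H : R -> R, H 0 = 0 & forall x : R, -1 < x -> is_derive x 1 H (h x).
Proof.
move=> ch; pose mu := @lebesgue_measure R.
pose F x := (\int[mu]_(t in [set` `[-1, x]]) (h t))%R.
have dF (x : R) : -1 < x -> is_derive x 1 F (h x).
  move=> x1; have /= := @continuous_FTC1_closed R h (-1) x (x + 1) _ _ x1 (ch x).
  case=> [||dF1 dF2].
  - by rewrite ltrDl.
  - apply: continuous_compact_integrable; first exact: segment_compact.
    exact: continuous_subspaceT.
  - by split; [exact: dF1|rewrite -derive1E; exact: dF2].
exists (fun x => F x - F 0); first by rewrite subrr.
move=> x x1; rewrite -[h x]subr0; have := dF x x1 => dFx.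
by apply: is_deriveB; exact: is_derive_cst.
Qed.

Lemma eq_is_derive_nbhs (f g : R -> R) (x a b d : R) : a < x < b ->
  (forall y, a < y < b -> f y = g y) -> is_derive x 1 f d -> is_derive x 1 g d.
Proof.
move=> xab fg; apply: near_eq_is_derive.
have : x \in `]a, b[%R by rewrite in_itv.
move=> /near_in_itvoo; apply: filterS => y; rewrite in_itv /= => /fg.
exact.
Qed.

Lemma zero_derive_cst (f : R -> R) (x y : R) :
  (forall z, `|z - x| <= `|y - x| -> is_derive z 1 f 0) -> f y = f x.
Proof.
move=> df; have [c _] := @mvt_center R f (fun _ => 0) x y df.
by rewrite mul0r => /eqP; rewrite subr_eq0 => /eqP.
Qed.

(** The fundamental theorem from the base point -1 reaches only [x > -1]; the other half is the same
    statement for the reflected function. Both primitives vanish at 0, hence agree on the overlap of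
    their domains. *)
Lemma primitive_exists (h : R -> R) : continuous h ->
  exists2 H : R -> R, H 0 = 0 & forall x : R, is_derive x 1 H (h x).
Proof.
move=> ch; have [F F0 dF] := right_primitive ch.
have chN : continuous (fun x => - h (- x)).
  by move=> x; apply: cvgN; apply: (cvg_comp -%R h); [apply: cvgN; exact: cvg_id|exact: ch].
have [G G0 dG] := right_primitive chN.
have dG' (x : R) : x < 1 -> is_derive x 1 (fun x => G (- x)) (h x).
  move=> x1; have := @is_derive1_comp R G -%R x (- h (- - x)) (-1).
  rewrite opprK mulrN1 opprK; apply.
  by rewrite -[in X in - h X](opprK x); apply: dG; rewrite ltrN2.
have FG (x : R) : -1 < x < 1 -> F x = G (- x).
  move=> x1; suff : (fun x => F x - G (- x)) x = (fun x => F x - G (- x)) 0.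
    by rewrite /= F0 oppr0 G0 subrr => /eqP; rewrite subr_eq0 => /eqP.
  apply: (@zero_derive_cst (fun x => F x - G (- x))) => z; rewrite !subr0 => zx.
  have z1 : `|z| < 1 by rewrite (le_lt_trans zx)// ltr_norml.
  move: z1; rewrite ltr_norml => /andP[z1 z2].
  rewrite -(subrr (h z)); have := dF z z1; have := dG' z z2 => d1 d2.
  exact: is_deriveB.
exists (fun x => if 0 <= x then F x else G (- x)); first by rewrite lexx.
(* The split is at 1/2 rather than at the seam 0, so that every point has a neighbourhood on which
   the glued function equals a single branch. *)
move=> x; have [x0|x0] := ltP x (2^-1).
- apply: (@eq_is_derive_nbhs (fun x => G (- x)) _ x (x - 1) (2^-1)); last first.
  + by apply: dG'; lra.
  + move=> y yy; case: ifP => y0 //; rewrite FG //; lra.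
  + by rewrite x0; lra.
- apply: (@eq_is_derive_nbhs F _ x 0 (x + 1)).
  + by apply/andP; split; lra.
  + by move=> y /andP[y0 _]; rewrite ltW.
  + by apply: dF; lra.
Qed.

Definition integral0 (h : R -> R) : R -> R :=
  if pselect (continuous h) is left ch
  then s2val (cid2 (primitive_exists ch)) else fun=> 0.

Lemma integral00 (h : R -> R) : integral0 h 0 = 0.
Proof. by rewrite /integral0; case: pselect => // ch; case: cid2. Qed.

Lemma is_derive_integral0 (h : R -> R) (x : R) : continuous h -> is_derive x 1 (integral0 h) (h x).
Proof. by rewrite /integral0; case: pselect => // ch _; case: cid2. Qed.

Lemma is_derive_eps (h : R -> R) (x l : R) :
  (forall e, 0 < e -> exists2 d, 0 < d &
     forall y, `|y - x| < d -> `|h y - h x - l * (y - x)| <= e * `|y - x|) ->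
  is_derive x 1 h l.
Proof.
move=> H; apply/is_derive1_caratheodory.
pose g z := if z == x then l else (h z - h x) / (z - x).
have gx : g x = l by rewrite /g eqxx.
exists g; split=> //.
  move=> z; rewrite /g; case: eqVneq => [->|zx]; first by rewrite !subrr mulr0.
  by rewrite divfK ?subr_eq0.
apply/cvgrPdist_le => e e0 /=; have [d d0 hd] := H e e0.
near=> z; rewrite gx /g; case: eqVneq => [_|zx]; first by rewrite subrr normr0 ltW.
have zx0 : z - x != 0 by rewrite subr_eq0.
have -> : l - (h z - h x) / (z - x) = - (h z - h x - l * (z - x)) / (z - x).
  by field.
rewrite normrM normfV normrN ler_pdivrMr ?normr_gt0//; apply: hd.
rewrite distrC; near: z; exact: cvgr_dist_lt.
Unshelve. all: by end_near. Qed.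

(** Tube argument: compactness of [[- M, M]] makes continuity in the parameter uniform in [x]. *)
Lemma Ck0_uniform k (M y e : R) : Ck 0 setT k -> 0 < e ->
  exists2 d, 0 < d & forall x z, `|x| <= M -> `|z - y| < d -> `|k x z - k x y| < e.
Proof.
move=> ck e0.
have /compact_near_coveringP cM : compact `[- M, M]%classic := @segment_compact R (- M) M.
have H : \forall z \near y, forall x, `[- M, M]%classic x -> `|k x z - k x y| < e.
  apply: (cM R (nbhs y) (fun z x => `|k x z - k x y| < e)) => x xM.
  have e2 : 0 < e / 2 by rewrite divr_gt0.
  have := Ck0_continuous ck (I : setT (x, y)); move=> /cvgrPdist_lt /(_ _ e2) /nbhs_square[d d0 hd].
  exists ([set x' | `|x' - x| < d], [set z | `|z - y| < d]).
    by split; apply/nbhs_ballP; exists d => //= w; rewrite -ball_normE /= distrC.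
  move=> [x' z] [/= hx hz].
  have h1 := hd x' z hx hz; have h2 := hd x' y hx.
  rewrite subrr normr0 in h2; have {}h2 := h2 d0; rewrite /= in h1 h2.
  rewrite (_ : _ - _ = (k x y - k x' y) - (k x y - k x' z)); last by ring.
  by rewrite (le_lt_trans (ler_normB _ _))// (splitr e) ltrD.
move: H => /nbhs_ballP[d /= d0 hd]; exists d => // x z xM zy.
apply: hd; first by rewrite -ball_normE /= distrC.
by rewrite /= in_itv /= -ler_norml.
Qed.

Lemma Ck0_line1 k (y : R) : Ck 0 setT k -> continuous (k^~ y).
Proof.
move=> ck x; have h1 : id z @[z --> x] --> x by exact: cvg_id.
have h2 : (fun=> y) z @[z --> x] --> y by exact: cvg_cst.
exact: (cvg_comp2 h1 h2 (Ck0_continuous ck (I : setT (x, y)))).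
Qed.

Definition pintegral k (x y : R) : R := integral0 (k^~ y) x.

Lemma pintegral0 k y : pintegral k 0 y = 0.
Proof. exact: integral00. Qed.

Lemma is_derive_pintegral1 k (x y : R) : Ck 0 setT k ->
  is_derive x 1 ((pintegral k)^~ y) (k x y).
Proof. by move=> ck; apply: is_derive_integral0; exact: Ck0_line1. Qed.

(** The Taylor remainder of the integral is the primitive of the Taylor remainder of [k]. Two mean
    value steps, in [x] and then in the parameter, bound it by the oscillation of [pd2 k], which is
    uniformly small on the compact range of [x]. *)
Lemma is_derive_pintegral2 k (x y : R) : Ck 0 setT k -> Ck 0 setT (pd2 k) ->
  (forall x y : R, derivable (k x) y 1) ->
  is_derive y 1 (pintegral k x) (pintegral (pd2 k) x y).
Proof.
move=> ck ck2 dk; apply: is_derive_eps => e e0.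
have e'0 : 0 < e / (`|x| + 1) by rewrite divr_gt0 // ltr_wpDl.
have [d d0 hd] := Ck0_uniform `|x| y ck2 e'0.
exists d => // z zy.
pose G w := pintegral k w z - pintegral k w y - pintegral (pd2 k) w y * (z - y).
have dG (w : R) : is_derive w 1 G (k w z - k w y - pd2 k w y * (z - y)).
  have h1 := is_derive_pintegral1 w z ck; have h2 := is_derive_pintegral1 w y ck.
  have h3 := is_derive_pintegral1 w y ck2.
  have h4 := is_deriveM h3 (is_derive_cst (z - y) w 1).
  by apply: is_derive_eq (is_deriveB (is_deriveB h1 h2) h4) _;
    rewrite scaler0 add0r [_ *: _]mulrC.
have [c] := @mvt_center R G _ 0 x (fun w _ => dG w).
rewrite !subr0 => cx; rewrite {2}/G !pintegral0 mul0r !subr0 => GE.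
rewrite -[X in `|X|]/(G x) GE normrM.
have [c'] := @mvt_center R (k c) (pd2 k c) y z
  (fun w _ => @derivableP _ _ _ _ _ _ (dk c w)).
move=> c'y ->; rewrite -mulrBl normrM.
have := hd c c' cx (le_lt_trans c'y zy); move=> /ltW hc.
rewrite mulrAC ler_wpM2r//.
rewrite (le_trans (ler_wpM2r (normr_ge0 x) hc))// mulrAC ler_pdivrMr ?ltr_wpDl//.
by rewrite ler_wpM2l ?lerDl// ltW.
Qed.

Lemma Ck0_pintegral k : Ck 0 setT k -> Ck 0 setT (pintegral k).
Proof.
move=> ck; apply/Ck0P => x y _; apply/cvgrPdist_lt => e e0 /=.
have e'0 : 0 < e / 2 / (`|x| + 1) by rewrite !divr_gt0 // ltr_wpDl.
have [d d0 hd] := Ck0_uniform `|x| y ck e'0.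
have := Ck0_continuous ck (I : setT (x, y)); move=> /cvgrPdist_lt /(_ _ ltr01) /nbhs_square[d1 d10 hd1].
pose M := `|k x y| + 1; have M0 : 0 < M by rewrite ltr_wpDl.
have d20 : 0 < e / 2 / M by rewrite !divr_gt0.
pose dd := Num.min d (Num.min d1 (e / 2 / M)).
have dd0 : 0 < dd by rewrite !lt_min d0 d10.
apply: filterS (near_square x y dd0) => -[x' y'] /=.
rewrite !lt_min => -[/and3P[hx1 hx2 hx3] /and3P[hy1 hy2 hy3]].
have [c cx cE] := @mvt_center R ((pintegral k)^~ y') (k^~ y') x x'
  (fun w _ => is_derive_pintegral1 w y' ck).
have [c' cx' cE'] := @mvt_center R (fun w => pintegral k w y' - pintegral k w y)
  (fun w => k w y' - k w y) 0 x
  (fun w _ => @is_deriveB _ _ _ _ _ _ _ _ _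
     (is_derive_pintegral1 w y' ck) (is_derive_pintegral1 w y ck)).
move: cE'; rewrite !pintegral0 !subr0 => cE'.
rewrite !subr0 in cx'.
rewrite distrC (_ : _ - _ = (pintegral k x' y' - pintegral k x y') +
  (pintegral k x y' - pintegral k x y)); last by ring.
rewrite (le_lt_trans (ler_normD _ _))// cE cE' (splitr e) !normrM ltr_leD//.
- have kM : `|k c y'| <= M.
    have /= := hd1 c y' (le_lt_trans cx hx2) hy2.
    rewrite distrC => h; rewrite -(subrK (k x y) (k c y')) (le_trans (ler_normD _ _))//.
    by rewrite addrC lerD2l ltW.
  by rewrite (le_lt_trans (ler_wpM2r (normr_ge0 _) kM))// mulrC -ltr_pdivlMr.
- have hc := ltW (hd c' y' cx' hy1).
  rewrite (le_trans (ler_wpM2r (normr_ge0 x) hc))// mulrAC ler_pdivrMr ?ltr_wpDl//.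
  by rewrite ler_wpM2l ?lerDl// divr_ge0// ltW.
Qed.

(** Integration gains an order in the first variable only; for the parameter, the class is that of
    the primitive of the derived kernel. *)
Lemma Ck_pintegral n k : Ck n setT k -> Ck n setT (pintegral (pd2 k)) ->
  Ck 0 setT (pd2 k) -> (forall x y : R, derivable (k x) y 1) ->
  Ck n.+1 setT (pintegral k).
Proof.
move=> Ck1 Ck2 C0 dk; have C1 := Ck_le openT (leq0n n) Ck1.
apply: (@CkS_intro _ n setT _ k (pintegral (pd2 k))) => //; first exact: openT.
- by move=> x y _; exact: is_derive_pintegral1.
- by move=> x y _; exact: is_derive_pintegral2.
Qed.

End Primitive.

(** * The angle variable of the oscillator *)

Section ExpQuotient.
Context {R : realType}.

Let kexp (x y : R) : R := expR (x * y).

Let Ck_kexp n : Ck n setT kexp.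
Proof.
apply: Ck_expR; first exact: openT.
by apply: CkM; [|apply: Ck_fst|apply: Ck_snd]; exact: openT.
Qed.

(* [expquot y = (exp y - 1) / y], extended smoothly by [1] at [y = 0]. *)
Definition expquot (y : R) : R := pintegral kexp 1 y.

Lemma mulr_expquot y : y * expquot y = expR y - 1.
Proof.
suff : (fun x => y * pintegral kexp x y - expR (x * y)) 1 =
       (fun x => y * pintegral kexp x y - expR (x * y)) 0.
  by rewrite /= pintegral0 mulr0 mul0r expR0 mul1r /expquot; lra.
apply: (@zero_derive_cst _ (fun x => y * pintegral kexp x y - expR (x * y))).
move=> x _; have h := is_derive_pintegral1 x y (Ck_kexp 0).
have h2 : is_derive x 1 (fun x => expR (x * y)) (expR (x * y) * y).
  have h3 := is_deriveM (is_derive_id x 1) (is_derive_cst y x 1).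
  have := @is_derive1_comp R expR (id * cst y) x _ _ (is_derive_expR _) h3.
  by move=> h4; apply: is_derive_eq h4 _; rewrite scaler0 add0r [_ *: _]mulr1.
apply: is_derive_eq (is_deriveB (is_deriveM (is_derive_cst y x 1) h) h2) _.
by rewrite scaler0 addr0 [_ *: _]mulrC subrr.
Qed.

Lemma expquot_gt0 y : 0 < expquot y.
Proof.
have [c _] := @mvt_center R ((pintegral kexp)^~ y) (kexp^~ y) 0 1
  (fun z _ => is_derive_pintegral1 z y (Ck_kexp 0)).
by rewrite pintegral0 !subr0 mulr1 /expquot => ->; exact: expR_gt0.
Qed.

Lemma Ck1_expquot D f : open D -> Ck 1 D f -> Ck 1 D (fun x y : R => expquot (f x y)).
Proof.
move=> oD Cf.
have C1 : Ck 1 setT (pintegral kexp).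
  apply: Ck_pintegral.
  - exact: (Ck_kexp 0).
  - exact: Ck0_pintegral (Ck_pd2 (Ck_kexp 1)).
  - exact: Ck_pd2 (Ck_kexp 1).
  - by move=> x y; have [/(_ x y I)[]] := (CkSP _ _ _).1 (Ck_kexp 1).
exact: (@Ck_comp _ 1 D setT _ _ _ oD openT (fun _ _ _ => I) C1 (Ck_cst 1 1 oD) Cf).
Qed.

End ExpQuotient.

(** * The function K, the time map and its period *)

Section Angle.
Context {R : realType} (m : R) (m1 : 1 < m).

Let m0 : 0 < m. Proof. by rewrite (lt_trans ltr01). Qed.

Lemma sqr_powR_le (a s : R) : 0 <= a -> `|s| <= 1 -> (s ^+ 2) `^ a <= 1.
Proof.
move=> a0 s1; have [->|s0] := eqVneq s 0.
  have [->|a0'] := eqVneq a 0; first by rewrite powRr0.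
  by rewrite expr0n /= powR0.
apply: (@le_trans _ _ (1 `^ a)); last by rewrite powR1.
apply: ge0_ler_powR => //; rewrite ?nnegrE ?sqr_ge0//.
by rewrite -real_normK ?num_real// expr_le1.
Qed.

(** Away from 0 this is the chain rule. At 0, [m > 1] gives [(y^2)^m <= y^2] for [|y| < 1], so the
    derivative is 0. *)
Lemma is_derive_sqr_powR (s : R) :
  is_derive s 1 (fun s : R => (s ^+ 2) `^ m) (2 * m * (s * (s ^+ 2) `^ (m - 1))).
Proof.
have [->|s0] := eqVneq s 0.
  rewrite mul0r mulr0; apply: is_derive_eps => e e0.
  exists (Num.min 1 e); first by rewrite lt_min ltr01.
  move=> y; rewrite subr0 lt_min => /andP[y1 ye].
  rewrite mul0r subr0 expr0n /= (powR0 (lt0r_neq0 m0)) subr0.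
  rewrite ger0_norm ?powR_ge0//.
  have -> : (y ^+ 2) `^ m = y ^+ 2 * (y ^+ 2) `^ (m - 1).
    by rewrite mulr_powRB1 ?sqr_ge0.
  have h1 : (y ^+ 2) `^ (m - 1) <= 1 by rewrite sqr_powR_le ?subr_ge0 ?ltW.
  rewrite (le_trans (ler_wpM2l (sqr_ge0 _) h1))// mulr1 -real_normK ?num_real//.
  by rewrite expr2 ler_wpM2r// ltW.
have s20 : 0 < s ^+ 2 by rewrite exprn_even_gt0.
have h1 := @is_derive1_powR R m (s ^+ 2) s20.
have h2 := @is_deriveX R R id 2 s 1 1 (is_derive_id s 1).
have := @is_derive1_comp R (fun x => x `^ m) (id ^+ 2) s _ _ h1 h2.
move=> h; apply: is_derive_eq h _.
by rewrite /= [_ *: _]mulr1 expr1; ring.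
Qed.

Lemma Ck0_mul_sqr_powR : Ck 0 setT (fun s _ : R => s * (s ^+ 2) `^ (m - 1)).
Proof.
apply: Ck0_1d => s _ _; have [->|s0] := eqVneq s 0.
  apply/cvgrPdist_le => e e0 /=.
  have d0 : 0 < Num.min 1 e by rewrite lt_min ltr01.
  apply: filterS (near_dist 0 d0) => y /=.
  rewrite subr0 lt_min => /andP[y1 ye].
  rewrite mul0r sub0r normrN normrM (ger0_norm (powR_ge0 _ _)).
  have h1 : (y ^+ 2) `^ (m - 1) <= 1 by rewrite sqr_powR_le ?subr_ge0 ?ltW.
  by rewrite (le_trans (ler_wpM2l (normr_ge0 _) h1))// mulr1 ltW.
have s20 : 0 < s ^+ 2 by rewrite exprn_even_gt0.
have h1 := @is_derive1_powR R (m - 1) (s ^+ 2) s20.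
have h2 := @is_deriveX R R id 2 s 1 1 (is_derive_id s 1).
have h := @is_derive1_comp R (fun x => x `^ (m - 1)) (id ^+ 2) s _ _ h1 h2.
have h3 := is_deriveM (is_derive_id s 1) h.
exact/differentiable_continuous/derivable1_diffP/(@ex_derive _ _ _ _ _ _ _ h3).
Qed.

Lemma Ck1_sqr_powR D f : open D -> Ck 1 D f -> Ck 1 D (fun x y : R => (f x y ^+ 2) `^ m).
Proof.
move=> oD; apply: (@Ck_comp1 _ 1 D setT (fun s => (s ^+ 2) `^ m)) => //; first exact: openT.
apply: (Ck_cst_snd openT (fun x y _ => is_derive_sqr_powR x)).
by apply: CkM; [exact: openT|apply: Ck_cst; exact: openT|exact: Ck0_mul_sqr_powR].
Qed.

(* [K] of the header with [m = (p + 1) / 2]; powers of [sin ^ 2] avoid absolute values. *)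
Definition angK (x : R) : R :=
  if cos x == 0 then 1 else (1 - (sin x ^+ 2) `^ m) / (m * cos x ^+ 2).

Lemma sin2_cos0 (x : R) : cos x = 0 -> sin x ^+ 2 = 1.
Proof. by move=> c0; have := cos2Dsin2 x; rewrite c0 expr0n add0r. Qed.

Lemma angK_eq x : m * angK x * cos x ^+ 2 = 1 - (sin x ^+ 2) `^ m.
Proof.
rewrite /angK; case: eqVneq => [c0|c0].
  by rewrite (sin2_cos0 c0) powR1 c0 expr0n mulr0 subrr.
by field; rewrite c0 gt_eqF.
Qed.

(** The definition is 0/0 where [cos x = 0]. With [l = ln (sin^2 x)] and [E = expquot], the
    numerator is [- m l E(m l)] and the denominator [- m l E(l)]; the factor [m l] cancels and the
    result is regular at [l = 0]. *)
Lemma angK_expquot x : sin x != 0 ->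
  angK x = expquot (m * ln (sin x ^+ 2)) / expquot (ln (sin x ^+ 2)).
Proof.
move=> s0; have s20 : 0 < sin x ^+ 2 by rewrite exprn_even_gt0.
rewrite /angK; case: eqVneq => [c0|c0].
  by rewrite (sin2_cos0 c0) ln1 mulr0 divff// gt_eqF// expquot_gt0.
have := mulr_expquot (m * ln (sin x ^+ 2)); have := mulr_expquot (ln (sin x ^+ 2)).
have E0 := expquot_gt0 (ln (sin x ^+ 2)).
rewrite lnK ?posrE// => e1.
have -> : expR (m * ln (sin x ^+ 2)) = (sin x ^+ 2) `^ m.
  by rewrite /powR gt_eqF.
move=> e2.
have c2 : cos x ^+ 2 = - (ln (sin x ^+ 2) * expquot (ln (sin x ^+ 2))).
  by rewrite e1 -(cos2Dsin2 x); ring.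
have l0 : ln (sin x ^+ 2) != 0.
  by apply/eqP => l0; move: c2; rewrite l0 mul0r oppr0 => /eqP; rewrite sqrf_eq0 (negPf c0).
rewrite -[1 - _]opprB -e2 c2.
by field; rewrite l0 !gt_eqF.
Qed.

Lemma open_neq0 f : Ck 0 setT f -> open [set z : R * R | f z.1 z.2 != 0].
Proof.
move=> cf; apply: (@open_comp _ _ (fun z : R * R => f z.1 z.2) [set x | x != 0]).
  by case=> x y _; exact: Ck0_continuous cf I.
exact: open_neq.
Qed.

(** The defining quotient is regular off the zeros of cos, the [expquot] formula off the zeros of
    sin, and there is no common zero. *)
Lemma Ck1_angK1 : Ck 1 setT (fun x _ : R => angK x).
Proof.
apply: Ck_local => x y _.
have os := open_neq0 (Ck_sin openT (Ck_fst 0 openT)).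
have oc := open_neq0 (Ck_cos openT (Ck_fst 0 openT)).
have [c0|c0] := eqVneq (cos x) 0.
  exists [set z : R * R | sin z.1 != 0].
    split; [exact: os|apply/eqP => /= s0; have := sin2_cos0 c0].
    by rewrite s0 expr0n /= => /esym/eqP; rewrite oner_eq0.
  set D := [set z : R * R | _] in os *.
  pose l (x y : R) : R := ln (sin x * sin x).
  have Cs := Ck_sin os (Ck_fst 1 os).
  have Cl : Ck 1 D l.
    apply: (Ck_ln os _ (CkM os Cs Cs)) => x' y' s0.
    by rewrite -expr2 exprn_even_gt0.
  have CE1 := Ck1_expquot os (CkM os (Ck_cst 1 m os) Cl).
  have CE2 := Ck1_expquot os Cl.
  apply: (eq_Ck os _ (Ck_div os (fun x' y' _ => expquot_gt0 (l x' y')) CE1 CE2)).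
  by move=> x' y' s0; rewrite angK_expquot // expr2.
exists [set z : R * R | cos z.1 != 0]; first by split; [exact: oc|exact: c0].
set D := [set z : R * R | _] in oc *.
have Cs := Ck_sin oc (Ck_fst 1 oc).
have Cc := Ck_cos oc (Ck_fst 1 oc).
have C1 := CkB oc (Ck_cst 1 1 oc) (Ck1_sqr_powR oc Cs).
have C2 := CkM oc (Ck_cst 1 m oc) (CkM oc Cc Cc).
have D0 x' y' : D (x', y') -> 0 < m * (cos x' * cos x').
  by move=> c0'; rewrite -expr2 mulr_gt0 ?exprn_even_gt0.
apply: (eq_Ck oc _ (Ck_div oc D0 C1 C2)).
by move=> x' y' c0'; rewrite /angK (negPf c0') -expr2.
Qed.

Definition dangK (x : R) : R := pd1 (fun x _ : R => angK x) x 0.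

Lemma is_derive_angK (x : R) : is_derive x 1 angK (dangK x).
Proof. exact: (is_derive_pd1 Ck1_angK1 (I : setT (x, 0))). Qed.

Lemma cos0_angK x : cos x = 0 -> angK x = 1.
Proof. by move=> c0; rewrite /angK c0 eqxx. Qed.

(** Derivative of [angK_eq], divided by [m cos x]. The factor [cos x] on the left is kept because
    the second derivative of the wave produces it; where it vanishes, both sides are 0 since
    [K = sin^2 = 1]. *)
Lemma dangK_eq x :
  dangK x * cos x = 2 * angK x * sin x - 2 * (sin x * (sin x ^+ 2) `^ (m - 1)).
Proof.
have [c0|c0] := eqVneq (cos x) 0.
  by rewrite c0 (cos0_angK c0) (sin2_cos0 c0) powR1; lra.
have dc := is_derive_cos x; have ds := is_derive_sin x; have dK := is_derive_angK x.
have d1 := is_deriveM (is_deriveM (is_derive_cst m x 1) dK) (is_deriveX 2 dc).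
have d2 := @is_derive1_comp R _ _ x _ _ (is_derive_sqr_powR (sin x)) ds.
have d3 := is_deriveB (is_derive_cst (1 : R) x 1) d2.
have E : (cst m * angK * cos ^+ 2) = (cst 1 - ((fun s => (s ^+ 2) `^ m) \o sin)).
  by apply/funext => z; exact: angK_eq.
rewrite -E in d3.
have := @derive_val _ _ _ _ _ _ _ d1; rewrite (@derive_val _ _ _ _ _ _ _ d3).
rewrite /cst /GRing.mul_fun /= /GRing.scale /= expr1 fctE.
move=> H; apply: (mulfI c0); apply: (mulfI (lt0r_neq0 m0)).
move: H; rewrite (_ : (cos ^+ 2) x = cos x ^+ 2) // => H.
by move: H; lra.
Qed.

Lemma sin2_le1 (x : R) : sin x ^+ 2 <= 1.
Proof. by rewrite -(cos2Dsin2 x) lerDr sqr_ge0. Qed.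

(** The mean value theorem for [z ^ m] on [[sin^2 x, 1]] gives [K = c^(m-1)] with [c] in that
    interval. At [sin x = 0] the value is [1 / m]. *)
Lemma angK_bounds x : (sin x ^+ 2) `^ (m - 1) <= angK x <= 1.
Proof.
have [c0|c0] := eqVneq (cos x) 0.
  rewrite cos0_angK // lexx andbT; apply: sqr_powR_le; last exact: sin_max.
  by rewrite subr_ge0 ltW.
have u1 := sin2_le1 x; set u := sin x ^+ 2 in u1 *.
have c2E : cos x ^+ 2 = 1 - u by rewrite -(cos2Dsin2 x) -/u addrK.
have c20 : 0 < 1 - u by rewrite -c2E exprn_even_gt0.
have KE := angK_eq x; rewrite -/u c2E in KE.
have [u0|u0] := eqVneq u 0.
  rewrite u0 powR0 ?subr_eq0 ?gt_eqF//.
  rewrite u0 powR0 ?gt_eqF// !subr0 mulr1 in KE.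
  have -> : angK x = m^-1 by rewrite -[RHS]mulr1 -KE; field; rewrite gt_eqF.
  by rewrite invr_ge0 (ltW m0)/= invf_le1 // ltW.
have u0' : 0 < u by rewrite lt_def u0 sqr_ge0.
have dp (z : R) : 0 < z -> is_derive z 1 (fun z : R => z `^ m) (m * z `^ (m - 1)).
  by move=> z0; exact: is_derive1_powR.
have cu1 : {within `[u, 1], continuous (fun z : R => z `^ m)}.
  apply: derivable_within_continuous => z; rewrite in_itv /= => /andP[uz _].
  exact: (@ex_derive _ _ _ _ _ _ _ (dp z (lt_le_trans u0' uz))).
have dpu (z : R) : z \in `]u, 1[%R -> is_derive z 1 (fun z : R => z `^ m) (m * z `^ (m - 1)).
  by rewrite in_itv /= => /andP[uz _]; exact: dp (lt_trans u0' uz).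
have [c] := MVT_segment u1 dpu cu1.
rewrite in_itv /= powR1 => /andP[uc c1] E.
have -> : angK x = c `^ (m - 1).
  apply: (mulfI (lt0r_neq0 m0)); apply: (mulIf (lt0r_neq0 c20)).
  by rewrite KE E.
have m10 : 0 <= m - 1 by rewrite subr_ge0 ltW.
have c0' : 0 < c by rewrite (lt_le_trans u0').
apply/andP; split.
  by apply: ge0_ler_powR => //; rewrite nnegrE ltW.
apply: (@le_trans _ _ (1 `^ (m - 1))); last by rewrite powR1.
by apply: ge0_ler_powR => //; rewrite nnegrE ltW.
Qed.

Lemma angK_le1 x : angK x <= 1.
Proof. by case/andP: (angK_bounds x). Qed.

(** From [u^m <= u] on [0, 1]. This bound later keeps [angM], a denominator of the amplitude, away
    from 0. *)
Lemma angK_ge x : m^-1 <= angK x.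
Proof.
have [c0|c0] := eqVneq (cos x) 0.
  by rewrite cos0_angK // invf_le1 // ltW.
have c20 : 0 < cos x ^+ 2 by rewrite exprn_even_gt0.
rewrite -(ler_pM2l m0) mulfV ?gt_eqF// -(ler_pM2r c20) mul1r angK_eq.
have -> : cos x ^+ 2 = 1 - sin x ^+ 2 by rewrite -(cos2Dsin2 x) addrK.
rewrite lerD2l lerN2.
have [->|s0] := eqVneq (sin x ^+ 2) 0; first by rewrite powR0 // gt_eqF.
by apply: ge1r_powR; rewrite ?(ltW m1)// sin2_le1 lt_def s0 sqr_ge0.
Qed.

Lemma angK_gt0 x : 0 < angK x.
Proof. by rewrite (lt_le_trans _ (angK_ge x))// invr_gt0. Qed.

Lemma bernoulli (c : R) n : 0 <= c <= 1 -> 1 - n%:R * c <= (1 - c) ^+ n.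
Proof.
move=> /andP[c0 c1]; elim: n => [|n IH]; first by rewrite mul0r subr0 expr0.
rewrite exprS (le_trans _ (ler_wpM2l _ IH)) ?subr_ge0//.
have : 0 <= n%:R * c ^+ 2 by rewrite mulr_ge0 // sqr_ge0.
by rewrite -natr1; lra.
Qed.

(** Quadratic contact of [K] with its maximum 1, which makes the limiting speed at [eps = 1] vanish
    at least linearly at [pi / 2], hence the divergence of the period. *)
Lemma angK_near1 : exists2 n : nat, (0 < n)%N & forall x, 1 - angK x <= n%:R * cos x ^+ 2.
Proof.
(* The exponent [m - 1] is rounded up to a natural number so that Bernoulli applies; the base is at
   most 1, so this only lowers the power. *)
pose n := (Num.bound (m - 1)).+1.
have m10 : 0 <= m - 1 by rewrite subr_ge0 ltW.
have mn : m - 1 <= n%:R.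
  by rewrite ltW// (lt_le_trans (archi_boundP m10))// ler_nat.
exists n => // x; have /andP[Kx _] := angK_bounds x.
rewrite lerBlDr -lerBlDl.
have [s0|s0] := eqVneq (sin x ^+ 2) 0.
  have -> : cos x ^+ 2 = 1 by have := cos2Dsin2 x; rewrite s0 addr0.
  rewrite mulr1 (le_trans _ (ltW (angK_gt0 x)))// subr_le0 ler1n.
  by [].
apply: le_trans Kx; apply: (@le_trans _ _ ((sin x ^+ 2) `^ n%:R)).
  rewrite powR_mulrn ?sqr_ge0// (_ : sin x ^+ 2 = 1 - cos x ^+ 2); last first.
    by rewrite -(cos2Dsin2 x) addrAC subrr add0r.
  by apply: bernoulli; rewrite sqr_ge0 -(cos2Dsin2 x) lerDl sqr_ge0.
by apply: ger_powR => //; rewrite sin2_le1 lt_def s0 sqr_ge0.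
Qed.

Lemma angKD2pi x : angK (x + 2 * pi) = angK x.
Proof. by rewrite /angK mulrC mulr_natr sinD2pi cosD2pi. Qed.

(* The angular speed [sqrt (1 - eps K)] for [eps = 1 - exp (- y)], so that every real [y] is admissible. *)
Definition angv (x y : R) : R := Num.sqrt (1 - angK x + angK x * expR (- y)).

Lemma angv_sqr_gt0 (x y : R) : 0 < 1 - angK x + angK x * expR (- y).
Proof.
by rewrite ltr_wpDl ?mulr_gt0 ?expR_gt0 ?angK_gt0// subr_ge0 angK_le1.
Qed.

Lemma sqr_angv (x y : R) : angv x y ^+ 2 = 1 - angK x + angK x * expR (- y).
Proof. by rewrite sqr_sqrtr // ltW // angv_sqr_gt0. Qed.

Lemma angv_gt0 (x y : R) : 0 < angv x y.
Proof. by rewrite sqrtr_gt0 angv_sqr_gt0. Qed.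

Lemma angv_le1 (x y : R) : 0 <= y -> angv x y <= 1.
Proof.
move=> y0; rewrite -(expr_le1 (n := 2)) ?(ltW (angv_gt0 x y))// sqr_angv.
have : angK x * expR (- y) <= angK x.
  by rewrite ger_pMr ?angK_gt0// -expR0 ler_expR oppr_le0.
by lra.
Qed.

Lemma angvD2pi (x y : R) : angv (x + 2 * pi) y = angv x y.
Proof. by rewrite /angv angKD2pi. Qed.

(* [gfun (angK x) y = K / (v + v ^ 2)] is [(1 / v - 1) / (1 - exp (- y))], smooth across [y = 0]. *)
Let dom : set (R * R) := [set z | 0 < 1 - z.1 + z.1 * expR (- z.2)].
Let gfun (k y : R) : R :=
  k / (Num.sqrt (1 - k + k * expR (- y)) + (1 - k + k * expR (- y))).

Let CkD0 n D : open D -> Ck n D (fun k y : R => 1 - k + k * expR (- y)).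
Proof.
move=> oD; have C1 := Ck_fst n oD.
exact: CkD oD (CkB oD (Ck_cst n 1 oD) C1)
  (CkM oD C1 (Ck_expR oD (CkN oD (Ck_snd n oD)))).
Qed.

Let open_dom : open dom.
Proof. exact: open_Ck0_gt0 (CkD0 0 openT). Qed.

Let Ck_gfun n : Ck n dom gfun.
Proof.
have C0 := CkD0 n open_dom; have d0 x y : dom (x, y) -> 0 < 1 - x + x * expR (- y) by [].
apply: (Ck_div open_dom _ (Ck_fst n open_dom) (CkD open_dom (Ck_sqrt open_dom d0 C0) C0)).
by move=> x y /d0 h; rewrite addr_gt0 ?sqrtr_gt0.
Qed.

Let Ck_gfunK (h : R -> R -> R) : Ck 1 dom h -> Ck 1 setT (fun x y => h (angK x) y).
Proof.
move=> Ch; exact: (@Ck_comp _ 1 setT dom _ _ _ openT open_dom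
  (fun x y _ => angv_sqr_gt0 x y) Ch Ck1_angK1 (Ck_snd 1 openT)).
Qed.

Definition angk (x y : R) : R := gfun (angK x) y.

Lemma angkE x y : angk x y = angK x / (angv x y + angv x y ^+ 2).
Proof. by rewrite sqr_angv. Qed.

Lemma Ck1_angk : Ck 1 setT angk.
Proof. exact: Ck_gfunK (Ck_gfun 1). Qed.

(** The y-derivative is taken in the smooth [gfun], before the C^1 function [K] is substituted, so
    no regularity is lost. *)
Lemma Ck1_dangk : Ck 1 setT (pd2 angk).
Proof. exact: Ck_gfunK (Ck_pd2 (Ck_gfun 2)). Qed.

Lemma derivable_angk (x y : R) : derivable (angk x) y 1.
Proof. by have [/(_ x y I)[]] := (CkSP _ _ _).1 Ck1_angk. Qed.

Lemma derivable_dangk (x y : R) : derivable (pd2 angk x) y 1.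
Proof. by have [/(_ x y I)[]] := (CkSP _ _ _).1 Ck1_dangk. Qed.

Let Ck1_angN2 : Ck 1 setT (pintegral (pd2 angk)).
Proof.
have C2 := Ck_pd2 Ck1_dangk.
exact: Ck_pintegral (CkS openT Ck1_dangk) (Ck0_pintegral C2) C2 derivable_dangk.
Qed.

Definition angN : R -> R -> R := pintegral angk.

(** The x-derivative is the C^1 integrand itself; the y-derivative is a primitive of [pd2 angk],
    again of class C^1. *)
Lemma Ck2_angN : Ck 2 setT angN.
Proof.
exact: Ck_pintegral Ck1_angk Ck1_angN2 (CkS openT Ck1_dangk) derivable_angk.
Qed.

(** The integral of [1 / angv] from 0 to [x], that is the rescaled time at which the angle [x] is
    reached. *)
Definition ang_time (x y : R) : R := x + (1 - expR (- y)) * angN x y.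

Lemma Ck2_ang_time : Ck 2 setT ang_time.
Proof.
have CE := CkB openT (Ck_cst 2 (1 : R) openT) (Ck_expR openT (CkN openT (Ck_snd 2 openT))).
exact: CkD openT (Ck_fst 2 openT) (CkM openT CE Ck2_angN).
Qed.

Lemma angk_angv x y : 1 + (1 - expR (- y)) * angk x y = (angv x y)^-1.
Proof.
have v0 := angv_gt0 x y; have := sqr_angv x y => v2.
have E : (1 - expR (- y)) * angK x = 1 - angv x y ^+ 2 by rewrite v2; ring.
rewrite angkE mulrA E; field.
by rewrite !gt_eqF// -?expr2 ?addr_gt0 ?exprn_gt0.
Qed.

Lemma is_derive_ang_time1 (x y : R) : is_derive x 1 (ang_time^~ y) (angv x y)^-1.
Proof.
have h := is_derive_pintegral1 x y (CkS openT Ck1_angk).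
have h2 := is_deriveD (is_derive_id x 1) (is_deriveM (is_derive_cst (1 - expR (- y)) x 1) h).
by apply: is_derive_eq h2 _; rewrite scaler0 addr0 -angk_angv.
Qed.

Lemma pd1_ang_time x y : pd1 ang_time x y = (angv x y)^-1.
Proof. exact: (@derive_val _ _ _ _ _ _ _ (is_derive_ang_time1 x y)). Qed.

Lemma ang_time0 y : ang_time 0 y = 0.
Proof. by rewrite /ang_time /angN pintegral0 mulr0 addr0. Qed.

Lemma derivable_within (f f' : R -> R) a b :
  (forall z : R, a <= z <= b -> is_derive z 1 f (f' z)) -> {within `[a, b], continuous f}.
Proof.
move=> df; apply: derivable_within_continuous => z; rewrite in_itv /= => zab.
exact: (@ex_derive _ _ _ _ _ _ _ (df z zab)).
Qed.

Lemma mvt_right (f f' : R -> R) (a b : R) : a <= b ->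
  (forall z : R, a <= z <= b -> is_derive z 1 f (f' z)) ->
  exists2 c, a <= c <= b & f b - f a = f' c * (b - a).
Proof.
move=> ab df; have [|c] := @MVT_segment R f f' a b ab _ (derivable_within df).
  by move=> z; rewrite in_itv /= => /andP[az zb]; apply: df; rewrite !ltW.
by rewrite in_itv /= => cab ?; exists c.
Qed.

Lemma ang_time_incr (y x x' : R) : x < x' -> ang_time x y < ang_time x' y.
Proof.
move=> xx; have [c _ E] := mvt_right (ltW xx) (fun z _ => is_derive_ang_time1 z y).
by rewrite -subr_gt0 E mulr_gt0 ?subr_gt0// invr_gt0 angv_gt0.
Qed.

Lemma ang_time_le (y x x' : R) : x <= x' -> ang_time x y <= ang_time x' y.
Proof. by rewrite le_eqVlt => /orP[/eqP->//|/(ang_time_incr y)/ltW]. Qed.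

Lemma ang_time_expand (y x x' : R) : 0 <= y -> x <= x' -> x' - x <= ang_time x' y - ang_time x y.
Proof.
move=> y0 xx; have [c _ ->] := mvt_right xx (fun z _ => is_derive_ang_time1 z y).
by rewrite ler_peMl ?subr_ge0// invf_ge1 ?angv_gt0 ?angv_le1.
Qed.

(** For [y >= 0] the speed is at most 1, so the inverse of the time map is nonexpanding, uniformly
    in [y]. Both uniqueness and joint continuity of the phase come from this bound. *)
Lemma ang_time_lipschitz (y x x' : R) : 0 <= y -> `|x' - x| <= `|ang_time x' y - ang_time x y|.
Proof.
move=> y0; wlog xx : x x' / x <= x'.
  move=> H; have [/H//|/ltW/H] := leP x x'.
  by rewrite distrC (distrC (ang_time _ _)).
have h := ang_time_expand y0 xx.
by rewrite !ger0_norm ?subr_ge0// -subr_ge0 (le_trans _ h)// subr_ge0.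
Qed.

Definition ang_period (y : R) : R := ang_time (2 * pi) y.
Definition angM (y : R) : R := angN (2 * pi) y.

Lemma ang_periodE y : ang_period y = 2 * pi + (1 - expR (- y)) * angM y.
Proof. by []. Qed.

Lemma ang_timeD2pi x y : ang_time (x + 2 * pi) y = ang_time x y + ang_period y.
Proof.
have dG (z : R) : is_derive z 1 (fun x => ang_time (x + 2 * pi) y - ang_time x y) 0.
  have h1 := is_derive_ang_time1 (z + 2 * pi) y; rewrite angvD2pi in h1.
  have h2 := is_deriveD (is_derive_id z 1) (is_derive_cst (2 * pi) z 1).
  have h3 := @is_derive1_comp R (ang_time^~ y) (id + cst (2 * pi)) z _ _ h1 h2.
  by apply: is_derive_eq (is_deriveB h3 (is_derive_ang_time1 z y)) _; lra.
have := @zero_derive_cst _ (fun x => ang_time (x + 2 * pi) y - ang_time x y) 0 x (fun z _ => dG z).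
by rewrite /= add0r ang_time0 subr0 => /eqP; rewrite subr_eq => /eqP ->; rewrite addrC.
Qed.

Let pd2_angv_inv_gt0 (x y : R) : 0 < pd2 (fun x y => (angv x y)^-1) x y.
Proof.
have h1 : is_derive y 1 (fun y => 1 - angK x + angK x * expR (- y)) (- (angK x * expR (- y))).
  have h2 := @is_derive1_comp R expR -%R y _ _ (is_derive_expR _) (is_deriveNid y 1).
  have h3 := is_deriveD (is_derive_cst (1 - angK x) y 1)
    (is_deriveM (is_derive_cst (angK x) y 1) h2).
  by apply: is_derive_eq h3 _; rewrite scaler0 /GRing.scale /=; ring.
have h2 := @is_derive1_powR R (- 2^-1) _ (angv_sqr_gt0 x y).
have h3 := @is_derive1_comp R (fun z => z `^ (- 2^-1)) _ y _ _ h2 h1.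
have E : (fun y => (angv x y)^-1) =
    (fun z => z `^ (- 2^-1)) \o (fun y => 1 - angK x + angK x * expR (- y)).
  by apply/funext => z; rewrite /= powRN powR12_sqrt // ltW // angv_sqr_gt0.
rewrite /pd2 E (@derive_val _ _ _ _ _ _ _ h3).
rewrite mulNr mulrNN; apply: mulr_gt0; last by rewrite mulr_gt0 ?angK_gt0 ?expR_gt0.
by rewrite mulr_gt0 ?invr_gt0// powR_gt0 // angv_sqr_gt0.
Qed.

Lemma pd2_ang_time x y : pd2 ang_time x y =
  expR (- y) * angN x y + (1 - expR (- y)) * pintegral (pd2 angk) x y.
Proof.
have h1 := is_derive_pintegral2 x y (CkS openT Ck1_angk) (CkS openT Ck1_dangk) derivable_angk.
have h2 := @is_derive1_comp R expR -%R y _ _ (is_derive_expR _) (is_deriveNid y 1).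
have h3 := is_deriveB (is_derive_cst (1 : R) y 1) h2.
have h4 := is_deriveD (is_derive_cst x y 1) (is_deriveM h3 h1).
rewrite [LHS](@derive_val _ _ _ _ _ _ _ h4) /GRing.scale /angN /=.
by rewrite (_ : (cst 1 - (expR \o -%R)) y = 1 - expR (- y)) //; ring.
Qed.

(** The quantity is 0 at [x = 0], and its x-derivative is the y-derivative of [1 / angv], positive
    because [K > 0]. The interchange of derivatives is read off [pd2_ang_time]. *)
Lemma pd2_ang_time_gt0 (x y : R) : 0 < x -> 0 < pd2 ang_time x y.
Proof.
move=> x0.
have dG (z : R) : is_derive z 1 (pd2 ang_time ^~ y) (pd2 (fun x y => (angv x y)^-1) z y).
  have -> : pd2 ang_time ^~ y = (fun x => expR (- y) * angN x y +
      (1 - expR (- y)) * pintegral (pd2 angk) x y).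
    by apply/funext => w; rewrite pd2_ang_time.
  have h1 := is_derive_pintegral1 z y (CkS openT Ck1_angk).
  have h2 := is_derive_pintegral1 z y (CkS openT Ck1_dangk).
  have h3 := is_deriveM (is_derive_cst (expR (- y)) z 1) h1.
  have h4 := is_deriveM (is_derive_cst (1 - expR (- y)) z 1) h2.
  apply: is_derive_eq (is_deriveD h3 h4) _.
  have g1 : is_derive y 1 (angk z) (pd2 angk z y) := @derivableP _ _ _ _ _ _ (@derivable_angk z y).
  have g2 := @is_derive1_comp R expR -%R y _ _ (is_derive_expR _) (is_deriveNid y 1).
  have g3 := is_deriveB (is_derive_cst (1 : R) y 1) g2.
  have g4 := is_deriveD (is_derive_cst (1 : R) y 1) (is_deriveM g3 g1).
  rewrite /pd2 (_ : (fun y => (angv z y)^-1) = cst 1 + (cst 1 - (expR \o -%R)) * angk z).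
    rewrite (@derive_val _ _ _ _ _ _ _ g4) /GRing.scale /=.
    by rewrite (_ : (cst 1 - (expR \o -%R)) y = 1 - expR (- y)) //; rewrite -/(pd2 angk z y); ring.
  by apply/funext => w; rewrite -angk_angv.
have [c _] := mvt_right (ltW x0) (fun z _ => dG z).
rewrite !pd2_ang_time /angN !pintegral0 !mulr0 addr0 !subr0 => ->.
by rewrite mulr_gt0 ?pd2_angv_inv_gt0.
Qed.

Let pi20 : 0 < 2 * pi :> R. Proof. by rewrite mulr_gt0 ?pi_gt0. Qed.

Lemma is_derive_Lfun (y : R) : is_derive y 1 ang_period (pd2 ang_time (2 * pi) y).
Proof. exact: (is_derive_pd2 Ck2_ang_time (I : setT (2 * pi, y))). Qed.

Lemma ang_period_incr (y y' : R) : y < y' -> ang_period y < ang_period y'.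
Proof.
move=> yy; have [c _ E] := mvt_right (ltW yy) (fun z _ => is_derive_Lfun z).
by rewrite -subr_gt0 E mulr_gt0 ?subr_gt0 ?pd2_ang_time_gt0.
Qed.

Lemma ang_period0 : ang_period 0 = 2 * pi.
Proof. by rewrite ang_periodE oppr0 expR0 subrr mul0r addr0. Qed.

(** The integrand [K / (v + v^2)] is at least [1 / (2 m)], over an interval of length [2 pi]. *)
Lemma angM_ge (y : R) : 0 <= y -> pi / m <= angM y.
Proof.
move=> y0; have [c _] := mvt_right (ltW pi20)
  (fun z _ => is_derive_pintegral1 z y (CkS openT Ck1_angk)).
rewrite pintegral0 !subr0 /angM /angN => ->; rewrite angkE.
have v1 := angv_le1 c y0; have v0 := angv_gt0 c y.
have v2 : angv c y + angv c y ^+ 2 <= 2.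
  by rewrite -[2]/(1 + 1) lerD // expr_le1 // ltW.
have v20 : 0 < angv c y + angv c y ^+ 2 by rewrite addr_gt0 ?exprn_gt0.
rewrite mulrAC ler_pdivlMr//.
apply: le_trans (ler_wpM2l _ v2) _; first by rewrite divr_ge0 ?pi_ge0 ?(ltW m0).
have -> : pi / m * 2 = m^-1 * (2 * pi) by ring.
by rewrite ler_pM2r // angK_ge.
Qed.

(* Near [x = pi / 2] the speed [1 / v] is at least of order
   [1 / (|x - pi / 2| + exp (- y / 2))], whose integral diverges logarithmically. *)
Lemma ang_period_unbounded (B : R) : exists2 y, 0 <= y & B <= ang_period y.
Proof.
have [n n0 Kn] := angK_near1.
have p2 : 2 <= pi :> R by exact: pi_ge2.
have nR : 0 < n%:R :> R by rewrite ltr0n.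
have n1 : 1 <= n%:R :> R by rewrite ler1n.
(* Chosen so that [- ln mu / n = y / (2 n) = |B|] for the [mu = exp (- y / 2)] below. *)
pose y := 2 * n%:R * `|B|; have y0 : 0 <= y by rewrite !mulr_ge0.
exists y => //.
pose mu := expR (- (y / 2)); have mu0 : 0 < mu by exact: expR_gt0.
have muE : mu ^+ 2 = expR (- y).
  by rewrite expr2 -expRD -opprD -splitr.
(* Time spent past the angle [pi / 2], minus the logarithm that it has to dominate. *)
pose G (z : R) := ang_time (z + pi / 2) y - n%:R^-1 * ln (z + mu).
have dG (z : R) : 0 <= z <= 1 -> is_derive z 1 G
    ((angv (z + pi / 2) y)^-1 - n%:R^-1 * (z + mu)^-1).
  move=> /andP[z0 z1].
  have g1 := is_deriveD (is_derive_id z 1) (is_derive_cst (pi / 2) z 1).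
  have g2 := @is_derive1_comp R (ang_time^~ y) (id + cst (pi / 2)) z _ _
    (is_derive_ang_time1 (z + pi / 2) y) g1.
  have g3 := is_deriveD (is_derive_id z 1) (is_derive_cst mu z 1).
  have zm : 0 < z + mu by rewrite ltr_wpDl.
  have g4 := @is_derive1_comp R (@ln R) (id + cst mu) z _ _ (@is_derive1_ln R _ zm) g3.
  have g5 := is_deriveM (is_derive_cst (n%:R^-1 : R) z 1) g4.
  by apply: is_derive_eq (is_deriveB g2 g5) _; rewrite scaler0 !addr0 !mulr1.
have [c c01 GE] := mvt_right ler01 dG.
have /andP[c0 c1] := c01.
have v0 := angv_gt0 (c + pi / 2) y.
have cm : 0 < c + mu by rewrite ltr_wpDl.
(* Here [cos (c + pi / 2) = - sin c], so [v^2 <= n sin^2 c + mu^2 <= n^2 (c + mu)^2]. *)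
have vle : angv (c + pi / 2) y <= n%:R * (c + mu).
  rewrite -(ler_pXn2r (n := 2)) ?nnegrE ?(ltW v0) ?mulr_ge0 ?(ltW cm)// sqr_angv -muE.
  have h1 := Kn (c + pi / 2); rewrite cosDpihalf sqrrN in h1.
  have h2 : angK (c + pi / 2) * mu ^+ 2 <= mu ^+ 2.
    by rewrite ger_pMl ?exprn_gt0 // angK_le1.
  have sc : sin c ^+ 2 <= c ^+ 2.
    rewrite ler_pXn2r ?nnegrE //; last first.
      by rewrite sin_ge0_pi // c0 (le_trans c1)// (le_trans _ p2)// ler1n.
    have [d _] := mvt_right c0 (fun z _ => is_derive_sin z).
    by rewrite sin0 !subr0 => ->; rewrite ler_piMl // cos_le1.
  have h3 : n%:R * sin c ^+ 2 <= n%:R * c ^+ 2 by rewrite ler_pM2l.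
  have h4 : mu ^+ 2 <= n%:R * mu ^+ 2 by rewrite ler_peMl // sqr_ge0.
  have h5 : n%:R * (c ^+ 2 + mu ^+ 2) <= n%:R * (c + mu) ^+ 2.
    rewrite ler_pM2l // sqrrD lerD2r lerDl -mulr_natl !mulr_ge0 // ltW //.
  have h6 : n%:R * (c + mu) ^+ 2 <= n%:R ^+ 2 * (c + mu) ^+ 2.
    by rewrite ler_pM2r ?exprn_gt0 // expr2 ler_peMl.
  by rewrite exprMn; lra.
have : 0 <= G 1 - G 0.
  rewrite GE subr0 mulr1 subr_ge0 -invfM lef_pV2 ?posrE ?mulr_gt0 //.
rewrite /G add0r => H.
have l1 : 0 <= n%:R^-1 * ln (1 + mu).
  by rewrite mulr_ge0 ?invr_ge0 ?ler0n // ln_ge0 // lerDl ltW.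
have l2 : n%:R^-1 * ln (0 + mu) = - `|B|.
  by rewrite add0r expRK /y; field; rewrite gt_eqF.
have P1 : 0 <= ang_time (pi / 2) y.
  by rewrite -(ang_time0 y) ang_time_le // divr_ge0 // pi_ge0.
have P2 : ang_time (1 + pi / 2) y <= ang_period y.
  by rewrite ang_time_le //; lra.
have := ler_norm B; rewrite l2 in H; lra.
Qed.

Lemma ang_period_surj (l : R) : 2 * pi <= l -> exists2 y, 0 <= y & ang_period y = l.
Proof.
move=> l2; have [y1 y10 ly1] := ang_period_unbounded l.
have [|y] := @IVT R ang_period 0 y1 l y10 (derivable_within (fun z _ => is_derive_Lfun z)).
  have L01 : ang_period 0 <= ang_period y1 by rewrite ang_period0 (le_trans l2).
  by rewrite (min_idPl L01) (max_idPr L01) ang_period0 l2.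
by rewrite in_itv /= => /andP[y0 _] ?; exists y.
Qed.

Lemma ang_time_surj (y l : R) : 0 <= y -> exists x, ang_time x y = l.
Proof.
move=> y0; have l0 := normr_ge0 l.
have dP (z : R) := is_derive_ang_time1 z y.
have e1 := ang_time_expand y0 l0; rewrite ang_time0 !subr0 in e1.
have e2 : - `|l| <= 0 by rewrite oppr_le0.
have {}e2 := ang_time_expand y0 e2; rewrite ang_time0 !sub0r opprK in e2.
have lN := ler_norm l; have lN' := ler_norm (- l); rewrite normrN in lN'.
have ll : - `|l| <= `|l| by lra.
have [|x _ Ex] := @IVT R (ang_time^~ y) (- `|l|) `|l| l ll (derivable_within (fun z _ => dP z)).
  have L01 : ang_time (- `|l|) y <= ang_time `|l| y by lra.
  by rewrite (min_idPl L01) (max_idPr L01); apply/andP; split; lra.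
by exists x.
Qed.

End Angle.

(** * The orbit attached to each radius *)

Section Oscillator.
Context {R : realType} (m T : R) (om qV : R -> R).
Hypotheses (m1 : 1 < m) (om0 : forall r, 0 < om r)
  (qV0 : forall r, 0 < qV r) (Tom : forall r, 2 * pi <= T * om r)
  (Com : Ck 2 setT (fun r _ : R => om r)) (CqV : Ck 2 setT (fun r _ : R => qV r)).

Let m0 : 0 < m. Proof. by rewrite (lt_trans ltr01). Qed.

Let setTI (x y : R) : (setT : set (R * R)) (x, y). Proof. by []. Qed.

(** Rescaled time is [om r * t], so an orbit of rescaled period [T * om r] has period [T] in [t],
    the same for all radii. *)
Definition eta (r : R) : R := s2val (cid2 (ang_period_surj m1 (Tom r))).

Lemma eta_ge0 r : 0 <= eta r.
Proof. by rewrite /eta; case: cid2. Qed.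

Lemma ang_period_eta r : ang_period m (eta r) = T * om r.
Proof. by rewrite /eta; case: cid2. Qed.

(** Strict monotonicity of [f] traps [e z] between [e r - d] and [e r + d]. It supplies the
    continuity of [eta] required by [is_derive_implicit]. *)
Lemma continuous_incr (f e : R -> R) (r : R) :
  (forall x y, x < y -> f x < f y) ->
  {for r, continuous (f \o e)} -> {for r, continuous e}.
Proof.
move=> fi cfe; apply/cvgrPdist_lt => d d0 /=.
have f1 : f (e r - d) < f (e r) by apply: fi; lra.
have f2 : f (e r) < f (e r + d) by apply: fi; lra.
pose d' := Num.min (f (e r) - f (e r - d)) (f (e r + d) - f (e r)).
have d'0 : 0 < d' by rewrite lt_min !subr_gt0 f1.
move/cvgrPdist_lt : cfe => /(_ d' d'0); apply: filterS => z /=.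
rewrite lt_min !ltr_norml => /andP[/andP[h1 h2] /andP[h3 h4]].
have mono x y : f x < f y -> x < y.
  by move=> fxy; rewrite ltNge; apply/negP; rewrite le_eqVlt => /orP[/eqP E|/fi]; 
    [move: fxy; rewrite E ltxx|rewrite ltNge (ltW fxy)].
by apply/andP; split; [have := mono (e z) (e r + d)|have := mono (e r - d) (e z)]; lra.
Qed.

Let CL : Ck 2 setT (fun x _ : R => ang_period m x).
Proof.
exact: (@Ck_comp _ 2 setT setT _ _ _ openT openT (fun _ _ _ => I)
  (Ck2_ang_time m1) (Ck_cst 2 (2 * pi) openT) (Ck_fst 2 openT)).
Qed.

Let dL (x : R) : R := pd1 (fun x _ : R => ang_period m x) x 0.

Let dLE x : dL x = pd2 (ang_time m) (2 * pi) x.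
Proof. exact: (@derive_val _ _ _ _ _ _ _ (is_derive_Lfun m1 x)). Qed.

Let dL_gt0 x : 0 < dL x.
Proof. by rewrite dLE; apply: pd2_ang_time_gt0 => //; rewrite mulr_gt0 ?pi_gt0. Qed.

Let dom (r : R) := pd1 (fun r _ : R => om r) r 0.

Let is_derive_om (r : R) : is_derive r 1 om (dom r).
Proof. exact: is_derive_pd1 Com (setTI r 0). Qed.

Let is_derive_c (r : R) : is_derive r 1 (fun r => T * om r) (T * dom r).
Proof.
by apply: is_derive_eq (is_deriveM (is_derive_cst T r 1) (is_derive_om r)) _; rewrite scaler0 addr0.
Qed.

Let is_derive_cont (f : R -> R) (x d : R) : is_derive x 1 f d -> {for x, continuous f}.
Proof.
move=> df; apply/differentiable_continuous/derivable1_diffP; exact: (@ex_derive _ _ _ _ _ _ _ df).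
Qed.

Let ceta (r : R) : {for r, continuous eta}.
Proof.
apply: (@continuous_incr (ang_period m)); first exact: ang_period_incr.
rewrite (_ : ang_period m \o eta = (fun r => T * om r)); first exact: is_derive_cont (is_derive_c r).
by apply/funext => z; exact: ang_period_eta.
Qed.

Let is_derive_eta (r : R) : is_derive r 1 eta (T * dom r / dL (eta r)).
Proof.
have h := @is_derive_implicit R setT (fun x _ => ang_period m x) eta (fun=> 0) (fun r => T * om r)
  r 0 (T * dom r) openT (setTI _ _) (CkS openT CL) (lt0r_neq0 (dL_gt0 (eta r)))
  ang_period_eta (@ceta r) (is_derive_cst 0 r 1) (is_derive_c r).
by apply: is_derive_eq h _; rewrite mulr0 subr0.
Qed.

(** Bootstrap: the derivative of [eta] is an expression in [eta], so class n yields class n + 1 as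
    long as the derivative of the period, of class C^1, allows it. *)
Lemma Ck2_eta : Ck 2 setT (fun r _ : R => eta r).
Proof.
have C0 : Ck 0 setT (fun r _ : R => eta r).
  by apply: Ck0_1d => r _ _; exact: ceta.
have step n : (n <= 1)%N -> Ck n setT (fun r _ : R => eta r) -> Ck n.+1 setT (fun r _ : R => eta r).
  move=> n1 Cn; apply: (Ck_cst_snd openT (fun r _ _ => is_derive_eta r)).
  have Cd : Ck n setT (fun x _ : R => dL x).
    by apply: (Ck_le openT n1); exact: Ck_pd1 CL.
  have Co : Ck n setT (fun r _ : R => T * dom r).
    apply: CkM openT (Ck_cst n T openT) _.
    by apply: (Ck_le openT n1); exact: Ck_pd1 Com.
  apply: Ck_div openT _ Co _; first by move=> *; exact: dL_gt0.
  exact: (@Ck_comp1 _ n setT setT dL _ openT openT (fun _ _ _ => I) Cd Cn).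
exact: step (step 0%N _ C0).
Qed.

Definition phase (r t : R) : R := sval (cid (ang_time_surj m1 (om r * t) (eta_ge0 r))).

Lemma ang_time_phase r t : ang_time m (phase r t) (eta r) = om r * t.
Proof. by rewrite /phase; case: cid. Qed.

(** Both angles are reached at the same rescaled time, because the orbit has rescaled period
    [T * om r]; the nonexpanding inverse then identifies them. *)
Lemma phaseDT r t : phase r (t + T) = phase r t + 2 * pi.
Proof.
have E : ang_time m (phase r (t + T)) (eta r) = ang_time m (phase r t + 2 * pi) (eta r).
  by rewrite ang_timeD2pi // !ang_time_phase ang_period_eta; ring.
have := ang_time_lipschitz m1 (phase r t + 2 * pi) (phase r (t + T)) (eta_ge0 r).
by rewrite E subrr normr0 normr_le0 subr_eq0 => /eqP.
Qed.

(** With the angle frozen at [phase r t], the defect [om r' * t' - ang_time m (phase r t) (eta r')]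
    is continuous and vanishes at [(r, t)]; it bounds the change of phase. *)
Let Ck0_phase : Ck 0 setT phase.
Proof.
apply/Ck0P => r t _.
have Cc : Ck 0 setT (fun r' t' => om r' * t' - ang_time m (phase r t) (eta r')).
  apply: CkB openT (CkM openT (Ck_le openT (leq0n 2) Com) (Ck_snd 0 openT)) _.
  exact: (@Ck_comp _ 0 setT setT _ _ _ openT openT (fun _ _ _ => I)
    (Ck_le openT (leq0n 2) (Ck2_ang_time m1)) (Ck_cst 0 (phase r t) openT) (Ck_le openT (leq0n 2) Ck2_eta)).
apply/cvgrPdist_lt => e e0 /=.
have /cvgrPdist_lt/(_ e e0) := Ck0_continuous Cc (setTI r t).
apply: filterS => z /=.
rewrite ang_time_phase subrr sub0r normrN -(ang_time_phase z.1 z.2) distrC => h.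
exact: le_lt_trans (ang_time_lipschitz m1 _ _ (eta_ge0 z.1)) h.
Qed.

Lemma is_derive_phase_t (r t : R) : is_derive t 1 (phase r) (om r * angv m (phase r t) (eta r)).
Proof.
have ct : {for t, continuous (phase r)}.
  have h1 : (fun=> r) z @[z --> t] --> r by exact: cvg_cst.
  have h2 : id z @[z --> t] --> t by exact: cvg_id.
  exact: (cvg_comp2 h1 h2 (Ck0_continuous Ck0_phase (setTI r t))).
have dc : is_derive t 1 (fun t => om r * t) (om r).
  by apply: is_derive_eq (is_deriveM (is_derive_cst (om r) t 1) (is_derive_id t 1)) _;
    rewrite scaler0 addr0 [_ *: _]mulr1.
have P0 : pd1 (ang_time m) (phase r t) (eta r) != 0.
  by rewrite pd1_ang_time // invr_neq0 // gt_eqF // angv_gt0.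
have h := @is_derive_implicit R setT (ang_time m) (phase r) (fun=> eta r) (fun t => om r * t)
  t 0 (om r) openT (setTI _ _) (CkS openT (Ck2_ang_time m1)) P0 (ang_time_phase r) ct
  (is_derive_cst (eta r) t 1) dc.
by apply: is_derive_eq h _; rewrite mulr0 subr0 pd1_ang_time // invrK.
Qed.

Let is_derive_phase_r (r t : R) : is_derive r 1 (phase^~ t)
  ((dom r * t - pd2 (ang_time m) (phase r t) (eta r) * (T * dom r / dL (eta r))) /
   pd1 (ang_time m) (phase r t) (eta r)).
Proof.
have ct : {for r, continuous (phase^~ t)} by exact: (@Ck0_line1 _ phase t Ck0_phase r).
have dc : is_derive r 1 (fun r => om r * t) (dom r * t).
  by apply: is_derive_eq (is_deriveM (is_derive_om r) (is_derive_cst t r 1)) _;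
    rewrite scaler0 add0r [_ *: _]mulrC.
have P0 : pd1 (ang_time m) (phase r t) (eta r) != 0.
  by rewrite pd1_ang_time // invr_neq0 // gt_eqF // angv_gt0.
exact: (@is_derive_implicit R setT (ang_time m) (phase^~ t) eta (fun r => om r * t)
  r _ (dom r * t) openT (setTI _ _) (CkS openT (Ck2_ang_time m1)) P0 (ang_time_phase^~ t) ct
  (is_derive_eta r) dc).
Qed.

(** The same bootstrap as for [eta], with both implicit derivatives expressed through the phase
    itself. *)
Lemma Ck2_phase : Ck 2 setT phase.
Proof.
have step n : (n <= 1)%N -> Ck n setT phase -> Ck n.+1 setT phase.
  move=> n1 Cn.
  have n2 : (n <= 2)%N by rewrite (leq_trans n1).
  have Ce := Ck_le openT n2 Ck2_eta.
  have Co := Ck_le openT n2 Com.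
  have Cdo : Ck n setT (fun r _ : R => dom r) by apply: (Ck_le openT n1); exact: Ck_pd1 Com.
  have CdL : Ck n setT (fun x _ : R => dL x) by apply: (Ck_le openT n1); exact: Ck_pd1 CL.
  have Cde : Ck n setT (fun r _ : R => T * dom r / dL (eta r)).
    apply: Ck_div openT _ (CkM openT (Ck_cst n T openT) Cdo) _; first by move=> *; exact: dL_gt0.
    exact: (@Ck_comp1 _ n setT setT dL _ openT openT (fun _ _ _ => I) CdL Ce).
  have CP2 := @Ck_comp _ n setT setT _ _ _ openT openT (fun _ _ _ => I)
    (Ck_le openT n1 (Ck_pd2 (Ck2_ang_time m1))) Cn Ce.
  have CP1 := @Ck_comp _ n setT setT _ _ _ openT openT (fun _ _ _ => I)
    (Ck_le openT n1 (Ck_pd1 (Ck2_ang_time m1))) Cn Ce.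
  have P10 x y : setT (x, y) -> 0 < pd1 (ang_time m) (phase x y) (eta x).
    by move=> _; rewrite pd1_ang_time // invr_gt0 angv_gt0.
  have C1 := Ck_div openT P10
    (CkB openT (CkM openT Cdo (Ck_snd n openT)) (CkM openT CP2 Cde)) CP1.
  have C2 := CkM openT Co (Ck_inv openT P10 CP1).
  apply: (CkS_intro openT (fun r t _ => is_derive_phase_r r t) _ C1 C2).
  by move=> r t _; rewrite pd1_ang_time // invrK; exact: is_derive_phase_t.
exact: step (step 0%N _ Ck0_phase).
Qed.

(** * The wave and its differential equation *)

Variables (p : R).
Hypothesis pm : p = 2 * m - 1.

Let p1 : p - 1 = 2 * (m - 1). Proof. by rewrite pm; ring. Qed.
Let p10 : 0 < p - 1. Proof. by rewrite p1 mulr_gt0 // subr_gt0. Qed.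

(** Normalised so that [(T om - 2 pi) ampl^(p-1) / qV = 1 - exp (- eta)], the [eps] of the rescaled
    oscillator; the root of [T om - 2 pi] itself is left to the factor [g]. *)
Definition ampl (r : R) : R := (qV r / angM m (eta r)) `^ (p - 1)^-1.

Let angM_gt0 r : 0 < angM m (eta r).
Proof.
by apply: lt_le_trans (angM_ge m1 (eta_ge0 r)); rewrite divr_gt0 ?pi_gt0.
Qed.

Let ratio_gt0 r : 0 < qV r / angM m (eta r).
Proof. by rewrite divr_gt0. Qed.

Lemma ampl_gt0 r : 0 < ampl r.
Proof. exact: powR_gt0. Qed.

Lemma Ck2_amp : Ck 2 setT (fun r _ : R => ampl r).
Proof.
apply: Ck_powR openT (fun r _ _ => ratio_gt0 r) _.
apply: Ck_div openT (fun r _ _ => angM_gt0 r) CqV _.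
exact: (@Ck_comp _ 2 setT setT _ _ _ openT openT (fun _ _ _ => I)
  (Ck2_angN m1) (Ck_cst 2 (2 * pi) openT) Ck2_eta).
Qed.

Lemma ampl_powR r : ampl r `^ (p - 1) = qV r / angM m (eta r).
Proof. by rewrite -powRrM mulVf ?gt_eqF// powRr1 // ltW. Qed.

Lemma ampl_le Q r : qV r <= Q -> ampl r <= (Q / (pi / m)) `^ (p - 1)^-1.
Proof.
move=> qQ; have Q0 : 0 <= Q by rewrite (le_trans _ qQ) // ltW.
have pm0 : 0 < pi / m by rewrite divr_gt0 ?pi_gt0.
have h : qV r / angM m (eta r) <= Q / (pi / m).
  apply: ler_pM => //; [exact: ltW|by rewrite invr_ge0 ltW|].
  by rewrite lef_pV2 ?posrE //; apply: angM_ge => //; exact: eta_ge0.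
apply: ge0_ler_powR => //; first by rewrite invr_ge0 ltW.
- by rewrite nnegrE ltW.
- by rewrite nnegrE divr_ge0 // ltW.
Qed.

Definition wave (r t : R) : R := ampl r * sin (phase r t).

Lemma Ck2_wave : Ck 2 setT wave.
Proof. exact: CkM openT Ck2_amp (Ck_sin openT Ck2_phase). Qed.

Lemma waveDT r t : wave r (t + T) = wave r t.
Proof. by rewrite /wave phaseDT mulrC [2 * _]mulrC mulr_natr sinD2pi mulrC. Qed.

Lemma wave_le r t : `|wave r t| <= ampl r.
Proof. by rewrite normrM (gtr0_norm (ampl_gt0 r)) ler_piMr ?(ltW (ampl_gt0 r)) // sin_max. Qed.

(** The full amplitude is attained when the phase reaches [pi / 2]; the nontriviality of the
    breather rests on this. *)
Lemma wave_neq0 r : exists t, wave r t != 0.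
Proof.
exists (ang_time m (pi / 2) (eta r) / om r).
have E : ang_time m (phase r (ang_time m (pi / 2) (eta r) / om r)) (eta r) = ang_time m (pi / 2) (eta r).
  by rewrite ang_time_phase mulrC divfK // gt_eqF.
have := ang_time_lipschitz m1 (pi / 2) (phase r (ang_time m (pi / 2) (eta r) / om r)) (eta_ge0 r).
rewrite E subrr normr0 normr_le0 subr_eq0 /wave => /eqP ->.
by rewrite sin_pihalf mulr1 gt_eqF // ampl_gt0.
Qed.

Let is_derive_angv (x y : R) : is_derive x 1 ((angv m)^~ y)
  (- ((1 - expR (- y)) * dangK m x) / (2 * angv m x y)).
Proof.
have dK := is_derive_angK m1 x.
have h1 := is_deriveD (is_deriveB (is_derive_cst (1 : R) x 1) dK)
  (is_deriveM dK (is_derive_cst (expR (- y)) x 1)).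
have v0 := angv_sqr_gt0 m1 x y.
have h2 := @is_derive1_comp R Num.sqrt _ x _ _ (@is_derive1_sqrt R _ v0) h1.
apply: is_derive_eq h2 _.
rewrite scaler0 add0r /GRing.scale /= -/(angv m x y).
by field; rewrite gt_eqF // angv_gt0.
Qed.

Lemma sqr_powR_half (w : R) : (w ^+ 2) `^ (m - 1) = `|w| `^ (p - 1).
Proof. by rewrite p1 powRrM (powR_mulrn 2 (normr_ge0 w)) real_normK ?num_real. Qed.

Let is_derive_wave_t (r t : R) : is_derive t 1 (wave r)
  (ampl r * (cos (phase r t) * (om r * angv m (phase r t) (eta r)))).
Proof.
have h1 := @is_derive1_comp R sin (phase r) t _ _ (is_derive_sin _) (is_derive_phase_t r t).
by apply: is_derive_eq (is_deriveM (is_derive_cst (ampl r) t 1) h1) _; rewrite scaler0 addr0.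
Qed.

Lemma wave_ode r t : pd2 (pd2 wave) r t =
  om r ^+ 2 * ((T * om r - 2 * pi) / qV r * (`|wave r t| `^ (p - 1) * wave r t) - wave r t).
Proof.
have E2 : pd2 wave r =
    (fun t => ampl r * (cos (phase r t) * (om r * angv m (phase r t) (eta r)))).
  by apply/funext => t'; exact: (@derive_val _ _ _ _ _ _ _ (is_derive_wave_t r t')).
have dp := is_derive_phase_t r t.
have h1 := @is_derive1_comp R cos (phase r) t _ _ (is_derive_cos _) dp.
have h2 := @is_derive1_comp R ((angv m)^~ (eta r)) (phase r) t _ _ (is_derive_angv _ _) dp.
have h3 := is_deriveM (is_derive_cst (om r) t 1) h2.
have h4 := is_deriveM (is_derive_cst (ampl r) t 1) (is_deriveM h1 h3).
rewrite {1}/pd2 E2 (@derive_val _ _ _ _ _ _ _ h4).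
rewrite /wave normrM (gtr0_norm (ampl_gt0 r)) powRM ?(ltW (ampl_gt0 r)) // ampl_powR -sqr_powR_half.
rewrite -ang_period_eta ang_periodE addrAC subrr add0r /GRing.scale /=.
rewrite /cst (_ : ((fun=> om r) * (angv m ^~ (eta r) \o phase r)) t = om r * angv m (phase r t) (eta r)) //.
set x := phase r t; set y := eta r.
have dK := dangK_eq m1 x; have v2 := sqr_angv m1 x y; have v0 := angv_gt0 m1 x y.
move: (angM_gt0 r); rewrite -/y => M0; have q0 := qV0 r.
set v := angv m x y in v2 v0 *.
set W := (sin x ^+ 2) `^ (m - 1) in dK *.
set e := expR (- y) in v2 *; set dk := dangK m x in dK *; set K := angK m x in v2 dK *.
(* By the normalisation of [ampl], the coefficient of the nonlinear term collapses to
   [eps = 1 - e]. *)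
have -> : (1 - e) * angM m y / qV r * (qV r / angM m y * W * (ampl r * sin x)) =
  (1 - e) * W * ampl r * sin x by field; rewrite !gt_eqF.
have -> : - ((1 - e) * dk) / (2 * v) * (om r * v) = - ((1 - e) * dk) / 2 * om r.
  by field; rewrite gt_eqF.
transitivity (ampl r * om r ^+ 2 * (- sin x * v ^+ 2 - (1 - e) / 2 * (dk * cos x))).
  by field.
(* With [v^2 = 1 - eps K] and the formula for [K' cos], all terms in [K] cancel and
   [- sin + eps W sin] remains. *)
by rewrite dK v2; field.
Qed.

End Oscillator.

(** * Radial functions near the origin *)

Section EuclideanNorm.
Context {R : realType}.
Implicit Types (x : 'rV[R]_3) (k i : 'I_3).

Lemma enorm_ge0 x : 0 <= enorm x.
Proof. exact: sqrtr_ge0. Qed.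

Lemma sqr_enorm x : enorm x ^+ 2 = \sum_(i < 3) x 0 i ^+ 2.
Proof. by rewrite sqr_sqrtr // sumr_ge0 // => i _; exact: sqr_ge0. Qed.

Lemma coord_le_enorm x i : `|x 0 i| <= enorm x.
Proof.
rewrite -(ler_pXn2r (n := 2)) ?nnegrE ?enorm_ge0 // real_normK ?num_real // sqr_enorm.
by rewrite (bigD1 i) //= lerDl sumr_ge0 // => j _; exact: sqr_ge0.
Qed.

Lemma enorm0 : enorm (0 : 'rV[R]_3) = 0.
Proof. by rewrite /enorm big1 ?sqrtr0 // => i _; rewrite mxE expr0n. Qed.

Lemma enorm_gt0 x : (0 < enorm x) = (x != 0).
Proof.
apply/idP/idP => [|x0]; first by apply: contraTneq => ->; rewrite enorm0 ltxx.
rewrite lt_def enorm_ge0 andbT; apply: contra_neq x0 => n0.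
apply/rowP => i; rewrite mxE; apply/eqP; rewrite -normr_le0 -n0.
exact: coord_le_enorm.
Qed.

Lemma sqr_enorm_shift x k h :
  enorm (h *: e3 k + x) ^+ 2 = enorm x ^+ 2 + 2 * h * x 0 k + h ^+ 2.
Proof.
rewrite !sqr_enorm (bigD1 k) // [in RHS](bigD1 k) //=.
under eq_bigr => i ik do rewrite !mxE /= (negPf ik) mulr0 add0r.
by rewrite !mxE !eqxx mulr1n; ring.
Qed.

Lemma enormZ_e3 k h : enorm (h *: e3 k : 'rV[R]_3) = `|h|.
Proof.
have := sqr_enorm_shift 0 k h; rewrite addr0 enorm0 mxE expr0n mulr0 !add0r.
by move/eqP; rewrite -[h ^+ 2]real_normK ?num_real // eqrXn2 ?enorm_ge0 // => /eqP.
Qed.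

Lemma enormZ x h : enorm (h *: x) = `|h| * enorm x.
Proof.
apply/eqP; rewrite -(eqrXn2 (n := 2)) ?mulr_ge0 ?enorm_ge0 // exprMn !sqr_enorm.
rewrite real_normK ?num_real // mulr_sumr; apply/eqP; apply: eq_bigr => i _.
by rewrite mxE exprMn.
Qed.

Lemma continuous_enorm : continuous (@enorm R).
Proof.
move=> x; apply: (@continuous_comp _ _ _ (fun x => \sum_(i < 3) x 0 i ^+ 2) Num.sqrt).
  apply: (@continuous_big _ _ +%R 0) => [|i _ {}x]; first exact: add_continuous.
  apply: (@continuous_comp _ _ _ (fun x : 'rV[R]_3 => x 0 i) (fun z => z ^+ 2)).
    exact: coord_continuous.
  exact: exprn_continuous.
exact: sqrt_continuous.
Qed.

Lemma is_derive_line (V W : normedModType R) (f : V -> W) (z v : V) (d : W) :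
  is_derive z v f d <-> is_derive (0 : R) 1 (fun h : R => f (h *: v + z)) d.
Proof.
have E : 'D_v f z = 'D_1 (fun h : R => f (h *: v + z)) (0 : R).
  rewrite /derive; set g1 := fun h => h^-1 *: _; set g2 := fun h => h^-1 *: _.
  suff -> : g1 = g2 by [].
  apply/funext => h; rewrite /g1 /g2 /=.
  by rewrite addr0 scale0r add0r [_ *: 1]mulr1.
split=> -[df <-].
  by rewrite E; apply: derivableP; exact: (derivable1P f z v).1 df.
by rewrite -E; apply: derivableP; exact: (derivable1P f z v).2 df.
Qed.

Lemma is_derive_affine (a b h : R) : is_derive h 1 (fun h : R => h * a + b) a.
Proof.
have h1 := is_deriveD (is_deriveM (is_derive_id h 1) (is_derive_cst a h 1)) (is_derive_cst b h 1).
by apply: is_derive_eq h1 _; rewrite scaler0 add0r addr0 [_ *: _]mulr1.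
Qed.

(** The derivative of [phi] is written [enorm x * d] so that the gradient becomes [x_k d] without
    quotients. The chain rule goes through the squared norm, a polynomial in [h]. *)
Lemma is_derive_enorm x k (phi : R -> R) (d : R) : x != 0 ->
  is_derive (enorm x) 1 phi (enorm x * d) ->
  is_derive (0 : R) 1 (fun h : R => phi (enorm (h *: e3 k + x))) (x 0 k * d).
Proof.
rewrite -enorm_gt0 => x0 dphi.
have E : (fun h : R => phi (enorm (h *: e3 k + x))) =
    (phi \o Num.sqrt) \o (fun h => h * (2 * x 0 k + h) + enorm x ^+ 2).
  apply/funext => h /=; congr phi.
  have -> : h * (2 * x 0 k + h) + enorm x ^+ 2 = enorm (h *: e3 k + x) ^+ 2.
    by rewrite sqr_enorm_shift; ring.
  by rewrite sqrtr_sqr ger0_norm ?enorm_ge0.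
rewrite E.
have h1 := is_deriveD (is_deriveM (is_derive_id (0 : R) 1)
  (is_deriveD (is_derive_cst (2 * x 0 k) (0 : R) 1) (is_derive_id (0 : R) 1)))
  (is_derive_cst (enorm x ^+ 2) (0 : R) 1).
have n2 : 0 < enorm x ^+ 2 by rewrite exprn_gt0.
have n2E : Num.sqrt (enorm x ^+ 2) = enorm x by rewrite sqrtr_sqr ger0_norm ?enorm_ge0.
have h2 := @is_derive1_sqrt R _ n2.
rewrite -{1}n2E in dphi.
have h3 := is_derive1_comp dphi h2.
have := @is_derive1_comp R (phi \o Num.sqrt)
  (fun h => h * (2 * x 0 k + h) + enorm x ^+ 2) 0 _ _ _ h1.
rewrite mul0r add0r => /(_ _ h3) h4; apply: is_derive_eq h4 _.
rewrite /GRing.scale /= n2E !add0r mul0r add0r addr0 mulr1 /cst [in (_ + id) _]/GRing.add /= addr0.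
by field; rewrite gt_eqF.
Qed.

End EuclideanNorm.

(** * Limits at r = 0 and their consequences at the origin *)

Section Vanish.
Context {R : realType}.
Implicit Types Z : R -> R -> R.

(** A joint limit: [r] tends to 0 from the right while the time is free to approach [t], as
    continuity on space-time demands. *)
Definition vanish Z := forall t : R,
  Z z.1 z.2 @[z --> within right_half (nbhs ((0 : R), t))] --> (0 : R).

Lemma vanish_eps Z : vanish Z <-> forall t e : R, 0 < e -> exists2 d, 0 < d &
  forall r s, 0 < r < d -> `|s - t| < d -> `|Z r s| < e.
Proof.
split=> H t.
  move=> e e0; have := H t => /cvgrPdist_lt /(_ e e0) /nbhs_square[d d0 hd].
  exists d => // r s /andP[r0 rd] st.
  have := hd r s; rewrite /= subr0 gtr0_norm // sub0r normrN; exact.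
apply/cvgrPdist_lt => e e0 /=; have [d d0 hd] := H t e e0.
apply: filterS (near_square 0 t d0) => -[r s] /=; rewrite subr0 /right_half /= => -[rd st] r0.
by rewrite sub0r normrN; apply: hd => //; rewrite r0 -(gtr0_norm r0).
Qed.

Lemma eq_vanish Z Z' : (forall r t, 0 < r -> Z r t = Z' r t) -> vanish Z -> vanish Z'.
Proof.
move=> E /vanish_eps H; apply/vanish_eps => t e e0; have [d d0 hd] := H t e e0.
by exists d => // r s rd st; rewrite -E ?hd //; case/andP: rd.
Qed.

Lemma vanishD Z Z' : vanish Z -> vanish Z' -> vanish (fun r t => Z r t + Z' r t).
Proof. by move=> H H' t; rewrite -[X in _ --> X](addr0 0); apply: cvgD; [exact: H|exact: H']. Qed.

Lemma vanishM Z G : vanish Z -> Ck 0 setT G -> vanish (fun r t => Z r t * G r t).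
Proof.
move=> H CG t; rewrite -[X in _ --> X](mul0r (G 0 t)); apply: cvgM; first exact: H.
apply: cvg_within_filter; exact: (Ck0_continuous CG (I : setT (0, t))).
Qed.

Lemma vanishZ Z a : vanish Z -> vanish (fun r t => a * Z r t).
Proof.
move=> H; apply: eq_vanish (vanishM H (Ck_cst 0 a openT)).
by move=> r t _; rewrite mulrC.
Qed.

Lemma vanish_norm Z : vanish Z -> vanish (fun r t => `|Z r t|).
Proof.
move=> /vanish_eps H; apply/vanish_eps => t e e0; have [d d0 hd] := H t e e0.
by exists d => // r s rd st; rewrite normr_id hd.
Qed.

Lemma vanish_continuous (F : 'rV[R]_3 * R -> R) Z (t : R) : F (0, t) = 0 -> vanish Z ->
  (forall x s, `|F (x, s)| <= Z (enorm x) s) -> (forall s, F (0, s) = 0) ->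
  {for (0, t), continuous F}.
Proof.
move=> Ft /vanish_eps HZ FZ F0; apply/cvgrPdist_lt => e e0 /=.
have [d d0 hd] := HZ t e e0.
have h1 : \forall z \near (((0 : 'rV[R]_3), t) : 'rV[R]_3 * R), enorm z.1 < d.
  have ce : enorm z.1 @[z --> ((0 : 'rV[R]_3), t)] --> enorm (0 : 'rV[R]_3).
    apply: (cvg_comp (fun z : 'rV[R]_3 * R => z.1) (@enorm R)); first exact: cvg_fst.
    exact: continuous_enorm.
  move/cvgrPdist_lt : ce => /(_ d d0); apply: filterS => z.
  by rewrite enorm0 sub0r normrN ger0_norm ?enorm_ge0.
have h2 : \forall z \near (((0 : 'rV[R]_3), t) : 'rV[R]_3 * R), `|z.2 - t| < d.
  have ce : z.2 @[z --> ((0 : 'rV[R]_3), t)] --> t by exact: cvg_snd.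
  move/cvgrPdist_lt : ce => /(_ d d0); apply: filterS => z.
  by rewrite distrC.
move: h1 h2; apply: filterS2 => -[x s] h1z h2z; rewrite Ft sub0r normrN.
have [->|x0] := eqVneq x 0; first by rewrite F0 normr0.
rewrite (le_lt_trans (FZ x s)) // (le_lt_trans (ler_norm _)) // hd //.
by rewrite enorm_gt0 x0.
Qed.

(** The bound says that [F] is [o(|x|)] at the origin. *)
Lemma vanish_derive (F : 'rV[R]_3 * R -> R) Z (t : R) (k : 'I_3) :
  F (0, t) = 0 -> vanish Z ->
  (forall x s, `|F (x, s)| <= enorm x * Z (enorm x) s) ->
  is_derive ((0 : 'rV[R]_3), t) (e3 k, 0) F 0.
Proof.
move=> Ft /vanish_eps HZ FZ; apply/is_derive_line; apply: is_derive_eps => e e0.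
have [d d0 hd] := HZ t e e0; exists d => // h; rewrite !subr0 => hd0.
rewrite mul0r subr0.
have -> : h *: (e3 k, (0 : R)) + ((0 : 'rV[R]_3), t) = (h *: e3 k, t) :> 'rV[R]_3 * R.
  by congr pair; rewrite /= ?addr0 // scaler0 add0r.
have -> : (0 : R) *: (e3 k, (0 : R)) + ((0 : 'rV[R]_3), t) = (0, t) :> 'rV[R]_3 * R.
  by rewrite scale0r add0r.
rewrite Ft subr0.
have [->|h0] := eqVneq h 0; first by rewrite scale0r Ft !normr0 mulr0.
rewrite (le_trans (FZ _ _)) // enormZ_e3 mulrC ler_wpM2r //.
by rewrite (le_trans (ler_norm _)) // ltW // hd ?subrr ?normr0 // normr_gt0 h0.
Qed.

End Vanish.

(** * Row-valued maps, component by component *)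

Section Rows.
Context {R : realType}.

Lemma continuous_rows (V : topologicalType) n (F : V -> 'rV[R]_n.+1) (z : V) :
  (forall c, {for z, continuous (fun z => F z 0 c)}) -> {for z, continuous F}.
Proof.
move=> cF; apply/cvgrPdist_le => e e0; near=> w.
rewrite /Num.Def.normr /= mx_normrE (bigmax_le _ (ltW e0)) //= => -[i c] _.
rewrite !mxE /= (ord1 i); move: c; near: w; apply: filter_forall => c.
have /cvgrPdist_le/(_ e e0) := cF c; exact.
Unshelve. all: by end_near. Qed.

Lemma is_derive_rows (V : normedModType R) n (F : V -> 'rV[R]_n.+1) (G : 'I_n.+1 -> R) (z v : V) :
  (forall c, is_derive z v (fun z => F z 0 c) (G c)) -> is_derive z v F (\row_c G c).
Proof.
move=> dF; have df : derivable F z v.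
  by apply/derivable_mxP => i c; rewrite (ord1 i); exact: (@ex_derive _ _ _ _ _ _ _ (dF c)).
split=> //; rewrite derive_mx //; apply/rowP => c; rewrite !mxE.
exact: (@derive_val _ _ _ _ _ _ _ (dF c)).
Qed.

Lemma C2_rows (V : normedModType R) n l (dir : 'I_n -> V) (U : V -> 'rV[R]_l.+1)
    (g1 : 'I_l.+1 -> 'I_n -> V -> R) (g2 : 'I_l.+1 -> 'I_n -> 'I_n -> V -> R) :
  (forall c, continuous (fun z => U z 0 c)) ->
  (forall c j, continuous (g1 c j)) ->
  (forall c j i, continuous (g2 c j i)) ->
  (forall c j z, is_derive z (dir j) (fun z => U z 0 c) (g1 c j z)) ->
  (forall c j i z, is_derive z (dir i) (g1 c j) (g2 c j i z)) ->
  [/\ C2 dir U, forall j, 'D_(dir j) U = fun z => \row_c g1 c j z &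
      forall j i, 'D_(dir i) ('D_(dir j) U) = fun z => \row_c g2 c j i z].
Proof.
move=> c0 c1 c2 d1 d2.
have D1 j : 'D_(dir j) U = fun z => \row_c g1 c j z.
  apply/funext => z; exact: (@derive_val _ _ _ _ _ _ _ (is_derive_rows (fun c => d1 c j z))).
have d2' j i z : is_derive z (dir i) ('D_(dir j) U) (\row_c g2 c j i z).
  rewrite D1; apply: is_derive_rows => c.
  by rewrite (_ : (fun z => _) = g1 c j) //; apply/funext => w; rewrite mxE.
have D2 j i : 'D_(dir i) ('D_(dir j) U) = fun z => \row_c g2 c j i z.
  apply/funext => z; exact: (@derive_val _ _ _ _ _ _ _ (d2' j i z)).
have rc (f : 'I_l.+1 -> V -> R) : (forall c, continuous (f c)) ->
    continuous (fun z => \row_c f c z).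
  move=> cf z; apply: continuous_rows => c.
  rewrite (_ : (fun z => _) = f c); first exact: cf.
  by apply/funext => w; rewrite mxE.
split => //; split; first by move=> z; apply: continuous_rows => c; exact: c0.
split; first by move=> j z; exact: (@ex_derive _ _ _ _ _ _ _ (is_derive_rows (fun c => d1 c j z))).
split; first by move=> j; rewrite D1; apply: rc => c; exact: c1.
split; first by move=> i j z; exact: (@ex_derive _ _ _ _ _ _ _ (d2' j i z)).
by move=> i j; rewrite D2; apply: rc => c; exact: c2.
Qed.

End Rows.

(** * Curl-free radial fields *)

Section RadialField.
Context {R : realType} (Y : R -> R -> R).
Notation V := ('rV[R]_3 * R)%type.

Let oD : open (@right_half R) := @open_right_half R.

Hypotheses (CY : Ck 2 right_half Y)
  (Y0 : vanish (fun r t => Y r t / r ^+ 2))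
  (Yr : vanish (fun r t => pd1 Y r t / r))
  (Yrr : vanish (pd1 (pd1 Y)))
  (Yt : vanish (fun r t => pd2 Y r t / r))
  (Yrt : vanish (pd2 (pd1 Y)))
  (Ytr : vanish (pd1 (pd2 Y)))
  (Ytt : vanish (pd2 (pd2 Y))).

(** [p1] and [p2] arise from [p0] by applying [(1/r) d/dr], since [d_k f(|x|) = x_k f'(r) / r].
    [q0], [q1] and [w0] carry the time derivatives. [q1] and [s1] differ by the order of the mixed
    derivative of [Y], because [C2] asks for both orders. *)
Let p0 r t := Y r t / r.
Let p1 r t := pd1 Y r t / r ^+ 2 - Y r t / r ^+ 3.
Let p2 r t := pd1 (pd1 Y) r t / r ^+ 3 - 3 * (pd1 Y r t / r ^+ 4) + 3 * (Y r t / r ^+ 5).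
Let q0 r t := pd2 Y r t / r.
Let q1 r t := pd2 (pd1 Y) r t / r ^+ 2 - pd2 Y r t / r ^+ 3.
Let s1 r t := pd1 (pd2 Y) r t / r ^+ 2 - pd2 Y r t / r ^+ 3.
Let w0 r t := pd2 (pd2 Y) r t / r.

Let is_deriveV_gt0 (g : R -> R) (r d : R) : 0 < g r -> is_derive r 1 g d ->
  is_derive r 1 (fun r => (g r)^-1) (- (g r) ^- 2 * d).
Proof. by move=> g0 dg; apply: is_deriveV => //; rewrite gt_eqF. Qed.

Let is_derive_mulI (f g : R -> R) (r d e : R) : is_derive r 1 f d -> is_derive r 1 g e ->
  is_derive r 1 (fun r => f r * g r) (f r * e + g r * d).
Proof. exact: is_deriveM. Qed.

Let is_derive_quot (f : R -> R) (r d : R) n : 0 < r -> is_derive r 1 f d ->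
  is_derive r 1 (fun r => f r / r ^+ n.+1) (d / r ^+ n.+1 - n.+1%:R * (f r / r ^+ n.+2)).
Proof.
move=> r0 df; have rn : 0 < r ^+ n.+1 by rewrite exprn_gt0.
have E : id ^+ n.+1 = (fun r : R => r ^+ n.+1).
  apply/funext => z; elim: n.+1 => [|k IH]; first by rewrite !expr0.
  by rewrite !exprS -IH.
have h1 := is_deriveX n.+1 (is_derive_id r 1); rewrite E in h1.
have h2 := is_derive_mulI df (@is_deriveV_gt0 (fun r : R => r ^+ n.+1) r _ rn h1).
apply: is_derive_eq h2 _.
rewrite /GRing.scale /= !exprS.
by field; rewrite expf_neq0 gt_eqF.
Qed.

Let is_derive_quot1 (f : R -> R) (r d : R) : 0 < r -> is_derive r 1 f d ->
  is_derive r 1 (fun r => f r / r) (d / r - f r / r ^+ 2).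
Proof.
move=> r0 df; have := is_derive_quot 0 r0 df; rewrite mul1r expr1.
by rewrite (_ : (fun _ => _) = (fun r => f r / r)) //; apply/funext => z; rewrite expr1.
Qed.

Let dY1 (r t : R) : 0 < r -> is_derive r 1 (Y^~ t) (pd1 Y r t).
Proof. by move=> r0; exact: (is_derive_pd1 CY (r0 : right_half (r, t))). Qed.
Let dY2 (r t : R) : 0 < r -> is_derive t 1 (Y r) (pd2 Y r t).
Proof. by move=> r0; exact: (is_derive_pd2 CY (r0 : right_half (r, t))). Qed.
Let dY11 (r t : R) : 0 < r -> is_derive r 1 ((pd1 Y)^~ t) (pd1 (pd1 Y) r t).
Proof. by move=> r0; exact: (is_derive_pd1 (Ck_pd1 CY) (r0 : right_half (r, t))). Qed.
Let dY12 (r t : R) : 0 < r -> is_derive t 1 (pd1 Y r) (pd2 (pd1 Y) r t).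
Proof. by move=> r0; exact: (is_derive_pd2 (Ck_pd1 CY) (r0 : right_half (r, t))). Qed.
Let dY21 (r t : R) : 0 < r -> is_derive r 1 ((pd2 Y)^~ t) (pd1 (pd2 Y) r t).
Proof. by move=> r0; exact: (is_derive_pd1 (Ck_pd2 CY) (r0 : right_half (r, t))). Qed.
Let dY22 (r t : R) : 0 < r -> is_derive t 1 (pd2 Y r) (pd2 (pd2 Y) r t).
Proof. by move=> r0; exact: (is_derive_pd2 (Ck_pd2 CY) (r0 : right_half (r, t))). Qed.

Let is_derive_mulC (f : R -> R) (t d a : R) : is_derive t 1 f d ->
  is_derive t 1 (fun t => f t / a) (d / a).
Proof.
move=> df; apply: is_derive_eq (is_deriveM df (is_derive_cst a^-1 t 1)) _.
by rewrite scaler0 add0r [_ *: _]mulrC.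
Qed.

Let dp0 (r t : R) : 0 < r -> is_derive r 1 (p0^~ t) (r * p1 r t).
Proof.
move=> r0; apply: is_derive_eq (is_derive_quot1 r0 (dY1 t r0)) _.
by rewrite /p1; field; rewrite gt_eqF.
Qed.

Let dp1 (r t : R) : 0 < r -> is_derive r 1 (p1^~ t) (r * p2 r t).
Proof.
move=> r0; apply: is_derive_eq (is_deriveB (is_derive_quot 1 r0 (dY11 t r0))
  (is_derive_quot 2 r0 (dY1 t r0))) _.
by rewrite /p2; field; rewrite gt_eqF.
Qed.

Let dq0 (r t : R) : 0 < r -> is_derive r 1 (q0^~ t) (r * s1 r t).
Proof.
move=> r0; apply: is_derive_eq (is_derive_quot1 r0 (dY21 t r0)) _.
by rewrite /s1; field; rewrite gt_eqF.
Qed.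

Let dp0t (r t : R) : 0 < r -> is_derive t 1 (p0 r) (q0 r t).
Proof. by move=> r0; exact: is_derive_mulC (dY2 t r0). Qed.

Let dp1t (r t : R) : 0 < r -> is_derive t 1 (p1 r) (q1 r t).
Proof.
by move=> r0; exact: is_deriveB (is_derive_mulC _ (dY12 t r0)) (is_derive_mulC _ (dY2 t r0)).
Qed.

Let dq0t (r t : R) : 0 < r -> is_derive t 1 (q0 r) (w0 r t).
Proof. by move=> r0; exact: is_derive_mulC (dY22 t r0). Qed.

Let Ck_exprV n : Ck 0 right_half (fun r _ : R => (r ^+ n)^-1).
Proof.
apply: Ck_inv oD _ _; first by move=> r t r0; rewrite exprn_gt0.
elim: n => [|n IH].
  by have := Ck_cst 0 (1 : R) oD; apply: eq_Ck oD _ => r t _; rewrite expr0.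
have := CkM oD (Ck_fst 0 oD) IH; apply: eq_Ck oD _ => r t _; exact: esym (exprS _ _).
Qed.

Let Ck_quot (f : R -> R -> R) n : Ck 0 right_half f -> Ck 0 right_half (fun r t => f r t / r ^+ n).
Proof. by move=> Cf; exact: CkM oD Cf (@Ck_exprV n). Qed.

Let CY0 : Ck 0 right_half Y. Proof. exact: Ck_le oD _ CY. Qed.
Let CY1 : Ck 0 right_half (pd1 Y). Proof. exact: CkS oD (Ck_pd1 CY). Qed.
Let CY2 : Ck 0 right_half (pd2 Y). Proof. exact: CkS oD (Ck_pd2 CY). Qed.

Let Cp0 : Ck 0 right_half p0. Proof. exact: (@Ck_quot Y 1 CY0). Qed.
Let Cp1 : Ck 0 right_half p1.
Proof. exact: CkB oD (@Ck_quot _ 2 CY1) (@Ck_quot _ 3 CY0). Qed.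
Let Cp2 : Ck 0 right_half p2.
Proof.
exact: CkD oD (CkB oD (@Ck_quot _ 3 (Ck_pd1 (Ck_pd1 CY)))
  (CkM oD (Ck_cst 0 (3 : R) oD) (@Ck_quot _ 4 CY1))) (CkM oD (Ck_cst 0 (3 : R) oD) (@Ck_quot _ 5 CY0)).
Qed.
Let Cq0 : Ck 0 right_half q0. Proof. exact: (@Ck_quot (pd2 Y) 1 CY2). Qed.
Let Cq1 : Ck 0 right_half q1.
Proof. exact: CkB oD (@Ck_quot _ 2 (Ck_pd2 (Ck_pd1 CY))) (@Ck_quot _ 3 CY2). Qed.
Let Cs1 : Ck 0 right_half s1.
Proof. exact: CkB oD (@Ck_quot _ 2 (Ck_pd1 (Ck_pd2 CY))) (@Ck_quot _ 3 CY2). Qed.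
Let Cw0 : Ck 0 right_half w0. Proof. exact: (@Ck_quot _ 1 (Ck_pd2 (Ck_pd2 CY))). Qed.

Let vp0r : vanish (fun r t => p0 r t / r).
Proof.
apply: eq_vanish Y0 => r t r0; rewrite /p0; field; by rewrite gt_eqF.
Qed.
(** The powers of [r] in this and the next four statements count the coordinates multiplying the
    coefficient in the second derivatives of the field, each coordinate being at most [r]. *)
Let vp1 : vanish (fun r t => r * p1 r t).
Proof.
apply: eq_vanish (vanishD Yr (vanishZ (- 1) Y0)) => r t r0; rewrite /p1; field; by rewrite gt_eqF.
Qed.
Let vp2 : vanish (fun r t => r ^+ 3 * p2 r t).
Proof.
apply: eq_vanish (vanishD Yrr (vanishD (vanishZ (- 3) Yr) (vanishZ 3 Y0))) => r t r0.
by rewrite /p2; field; rewrite gt_eqF.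
Qed.
Let vq1 : vanish (fun r t => r ^+ 2 * q1 r t).
Proof.
apply: eq_vanish (vanishD Yrt (vanishZ (- 1) Yt)) => r t r0; rewrite /q1; field; by rewrite gt_eqF.
Qed.
Let vs1 : vanish (fun r t => r ^+ 2 * s1 r t).
Proof.
apply: eq_vanish (vanishD Ytr (vanishZ (- 1) Yt)) => r t r0; rewrite /s1; field; by rewrite gt_eqF.
Qed.
Let vw0 : vanish (fun r t => r * w0 r t).
Proof. by apply: eq_vanish Ytt => r t r0; rewrite /w0; field; rewrite gt_eqF. Qed.
Let vrM (Z : R -> R -> R) : vanish Z -> vanish (fun r t => r * Z r t).
Proof.
move=> vZ; apply: eq_vanish (vanishM vZ (Ck_fst 0 openT)) => r t _; exact: mulrC.
Qed.
Let vp0 : vanish p0.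
Proof. by apply: eq_vanish (vrM vp0r) => r t r0; field; rewrite gt_eqF. Qed.

Let X i (z : V) := z.1 0 i.
Let rad (f : R -> R -> R) (z : V) := f (enorm z.1) z.2.

Let lineE (x : 'rV[R]_3) (t h : R) k : h *: (e3 k, (0 : R)) + (x, t) = (h *: e3 k + x, t) :> V.
Proof. by congr pair; rewrite /= scaler0 add0r. Qed.
Let lineEt (x : 'rV[R]_3) (t h : R) : h *: ((0 : 'rV[R]_3), (1 : R)) + (x, t) = (x, h + t) :> V.
Proof. by congr pair; rewrite /= ?scaler0 ?add0r // [_ *: _]mulr1. Qed.

Let dX i k (z : V) : is_derive z (e3 k, 0) (X i) ((i == k)%:R : R).
Proof.
case: z => x t; apply/is_derive_line.
rewrite (_ : (fun h => _) = (fun h : R => h * (i == k)%:R + x 0 i)); first exact: is_derive_affine.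
by apply/funext => h; rewrite lineE /X /= !mxE.
Qed.

Let dXt i (z : V) : is_derive z (0, 1) (X i) (0 : R).
Proof.
case: z => x t; apply/is_derive_line.
rewrite (_ : (fun h => _) = (fun h : R => x 0 i)); first exact: is_derive_cst.
by apply/funext => h; rewrite lineEt.
Qed.

Let drad (f g : R -> R -> R) k (z : V) : z.1 != 0 ->
  (forall r t : R, 0 < r -> is_derive r 1 (f^~ t) (r * g r t)) ->
  is_derive z (e3 k, 0) (rad f) (X k z * rad g z).
Proof.
case: z => x t /= x0 df; apply/is_derive_line.
rewrite (_ : (fun h => _) = (fun h : R => f (enorm (h *: e3 k + x)) t)).
  by apply: (@is_derive_enorm R x k (f^~ t)) => //; apply: df; rewrite enorm_gt0.
by apply/funext => h; rewrite lineE.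
Qed.

Let dradt (f g : R -> R -> R) (z : V) : z.1 != 0 ->
  (forall r t : R, 0 < r -> is_derive t 1 (f r) (g r t)) ->
  is_derive z (0, 1) (rad f) (rad g z).
Proof.
case: z => x t /= x0 df; apply/is_derive_line.
rewrite (_ : (fun h => _) = (fun h : R => f (enorm x) (h + t))).
  have /is_derive_line : is_derive t 1 (f (enorm x)) (g (enorm x) t).
    by apply: df; rewrite enorm_gt0.
  rewrite (_ : (fun h : R => f (enorm x) (h *: 1 + t)) = (fun h => f (enorm x) (h + t))) //.
  by apply/funext => h; rewrite [_ *: 1]mulr1.
by apply/funext => h; rewrite lineEt.
Qed.

Let cX i : continuous (X i).
Proof.
move=> z; apply: (cvg_comp (fun z : V => z.1) (fun x : 'rV[R]_3 => x 0 i)); first exact: cvg_fst.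
exact: coord_continuous.
Qed.

Let crad (f : R -> R -> R) (z : V) : Ck 0 right_half f -> z.1 != 0 -> {for z, continuous (rad f)}.
Proof.
case: z => x t Cf /= x0.
have h1 : enorm z.1 @[z --> (x, t)] --> enorm x.
  apply: (cvg_comp (fun z : V => z.1) (@enorm R)); first exact: cvg_fst.
  exact: continuous_enorm.
have h2 : z.2 @[z --> (x, t)] --> t by exact: cvg_snd.
apply: (cvg_comp2 h1 h2); apply: Ck0_continuous Cf _.
by rewrite /right_half /= enorm_gt0.
Qed.

(** Candidates for component [i] and its derivatives: a digit counts space derivatives, a [t] stands
    for a time derivative, in the order of application. On [x = 0] all of them vanish, thanks to the
    convention that the inverse of 0 is 0. *)
Let f0 i z := X i z * rad p0 z.
Let f1 i j z := (i == j)%:R * rad p0 z + X i z * X j z * rad p1 z.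
Let ft i z := X i z * rad q0 z.
Let f2 i j k z := (i == j)%:R * (X k z * rad p1 z) +
  (X i z * X j z * (X k z * rad p2 z) + rad p1 z * (X i z * (j == k)%:R + X j z * (i == k)%:R)).
Let f1t i j z := (i == j)%:R * rad q0 z + X i z * X j z * rad q1 z.
Let ft1 i j z := (i == j)%:R * rad q0 z + X i z * X j z * rad s1 z.
Let ftt i z := X i z * rad w0 z.

Let X0 i t : X i (0, t) = 0. Proof. by rewrite /X mxE. Qed.
Let rp00 t : rad p0 (0, t) = 0. Proof. by rewrite /rad /= enorm0 /p0 invr0 mulr0. Qed.
Let rq00 t : rad q0 (0, t) = 0. Proof. by rewrite /rad /= enorm0 /q0 invr0 mulr0. Qed.
Let f00 i t : f0 i (0, t) = 0. Proof. by rewrite /f0 X0 mul0r. Qed.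
Let f10 i j t : f1 i j (0, t) = 0. Proof. by rewrite /f1 X0 rp00 mulr0 !mul0r addr0. Qed.
Let ft0 i t : ft i (0, t) = 0. Proof. by rewrite /ft X0 mul0r. Qed.
Let f20 i j k t : f2 i j k (0, t) = 0.
Proof. by rewrite /f2 !X0 !mul0r !mulr0 ?(addr0, mulr0). Qed.
Let f1t0 i j t : f1t i j (0, t) = 0. Proof. by rewrite /f1t X0 rq00 mulr0 !mul0r addr0. Qed.
Let ft10 i j t : ft1 i j (0, t) = 0. Proof. by rewrite /ft1 X0 rq00 mulr0 !mul0r addr0. Qed.
Let ftt0 i t : ftt i (0, t) = 0. Proof. by rewrite /ftt X0 mul0r. Qed.

Let mulX (i : 'I_3) (z : V) (a b : R) : `|a| <= b -> `|X i z * a| <= enorm z.1 * b.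
Proof. by move=> ab; rewrite normrM ler_pM // coord_le_enorm. Qed.

Let delta_le (b : bool) (a c : R) : `|a| <= c -> `|b%:R * a| <= c.
Proof.
by case: b => ac; rewrite ?mul1r // mul0r normr0 (le_trans _ ac).
Qed.

Let bX i (f : R -> R -> R) x s : `|X i (x, s) * rad f (x, s)| <= enorm x * `|f (enorm x) s|.
Proof. exact: mulX. Qed.

Let bXX i j (f : R -> R -> R) x s :
  `|X i (x, s) * X j (x, s) * rad f (x, s)| <= `|enorm x ^+ 2 * f (enorm x) s|.
Proof.
rewrite normrM [leRHS]normrM (ger0_norm (sqr_ge0 _)) ler_wpM2r // expr2.
by apply: mulX; exact: coord_le_enorm.
Qed.

Let enormM (x : 'rV[R]_3) (a : R) : enorm x * `|a| = `|enorm x * a|.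
Proof. by rewrite normrM (ger0_norm (enorm_ge0 x)). Qed.

(** The factor [enorm x] is extracted because [f1] must itself be differentiated at the origin,
    through [vanish_derive]. *)
Let bf1 i j x s : `|f1 i j (x, s)| <=
  enorm x * (`|p0 (enorm x) s / enorm x| + `|enorm x * p1 (enorm x) s|).
Proof.
have [->|x0] := eqVneq x 0; first by rewrite f10 normr0 enorm0 mul0r.
rewrite mulrDr !enormM [enorm x * (enorm x * _)]mulrA -expr2 (le_trans (ler_normD _ _)) // lerD ?bXX //.
apply: delta_le; rewrite mulrCA mulfV ?mulr1 //.
by rewrite gt_eqF // enorm_gt0.
Qed.

Let bf2 i j k x s : `|f2 i j k (x, s)| <=
  3 * `|enorm x * p1 (enorm x) s| + `|enorm x ^+ 3 * p2 (enorm x) s|.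
Proof.
have bp l : `|X l (x, s) * rad p1 (x, s)| <= `|enorm x * p1 (enorm x) s|.
  by rewrite -enormM; exact: bX.
have b1 := delta_le (i == j) (bp k).
have b2 := delta_le (j == k) (bp i).
have b3 := delta_le (i == k) (bp j).
have b4 : `|X i (x, s) * X j (x, s) * (X k (x, s) * rad p2 (x, s))| <=
    `|enorm x ^+ 3 * p2 (enorm x) s|.
  have h := @mulX i (x, s) _ _ (@mulX j (x, s) _ _ (@mulX k (x, s) _ _ (lexx `|rad p2 (x, s)|))).
  rewrite -mulrA (le_trans h) //.
  by rewrite normrM (ger0_norm (exprn_ge0 _ (enorm_ge0 x))) !exprS expr0 mulr1 !mulrA.
rewrite /f2 (_ : _ + _ = (i == j)%:R * (X k (x, s) * rad p1 (x, s)) +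
  ((j == k)%:R * (X i (x, s) * rad p1 (x, s)) + ((i == k)%:R * (X j (x, s) * rad p1 (x, s)) +
  X i (x, s) * X j (x, s) * (X k (x, s) * rad p2 (x, s))))); last by ring.
have n1 := ler_normD ((i == j)%:R * (X k (x, s) * rad p1 (x, s)))
  ((j == k)%:R * (X i (x, s) * rad p1 (x, s)) + ((i == k)%:R * (X j (x, s) * rad p1 (x, s)) +
  X i (x, s) * X j (x, s) * (X k (x, s) * rad p2 (x, s)))).
have n2 := ler_normD ((j == k)%:R * (X i (x, s) * rad p1 (x, s)))
  ((i == k)%:R * (X j (x, s) * rad p1 (x, s)) +
  X i (x, s) * X j (x, s) * (X k (x, s) * rad p2 (x, s))).
have n3 := ler_normD ((i == k)%:R * (X j (x, s) * rad p1 (x, s)))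
  (X i (x, s) * X j (x, s) * (X k (x, s) * rad p2 (x, s))).
lra.
Qed.

Let bq i j (f : R -> R -> R) x s :
  `|(i == j)%:R * rad q0 (x, s) + X i (x, s) * X j (x, s) * rad f (x, s)| <=
  `|q0 (enorm x) s| + `|enorm x ^+ 2 * f (enorm x) s|.
Proof. by rewrite (le_trans (ler_normD _ _)) // lerD ?bXX // delta_le. Qed.

Let vZ1 : vanish (fun r s => `|p0 r s / r| + `|r * p1 r s|).
Proof. exact: vanishD (vanish_norm vp0r) (vanish_norm vp1). Qed.
Let vZ1' := vrM vZ1.

Let cont_of (F : V -> R) Z : (forall s, F (0, s) = 0) -> vanish Z ->
  (forall x s, `|F (x, s)| <= Z (enorm x) s) ->
  (forall z, z.1 != 0 -> {for z, continuous F}) -> continuous F.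
Proof.
move=> F0 vZ FZ cF [x t]; have [->|x0] := eqVneq x 0; last exact: cF.
exact: (vanish_continuous (F0 t) vZ FZ F0).
Qed.

Let cM (f g : V -> R) (z : V) : {for z, continuous f} -> {for z, continuous g} ->
  {for z, continuous (fun z => f z * g z)}.
Proof. by move=> cf cg; exact: cvgM. Qed.
Let cD (f g : V -> R) (z : V) : {for z, continuous f} -> {for z, continuous g} ->
  {for z, continuous (fun z => f z + g z)}.
Proof. by move=> cf cg; exact: cvgD. Qed.
Let cC (a : R) (z : V) : {for z, continuous (fun _ : V => a)}.
Proof. exact: cvg_cst. Qed.

Let cf0 i : continuous (f0 i).
Proof.
apply: (cont_of (f00 i) (vrM (vanish_norm vp0))) => [x s|z z0]; first exact: bX.
exact: cM (@cX i z) (crad Cp0 z0).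
Qed.

Let cf1 i j : continuous (f1 i j).
Proof.
apply: (cont_of (f10 i j) vZ1') => [x s|z z0]; first exact: bf1.
exact: cD (cM (@cC (i == j)%:R z) (crad Cp0 z0)) (cM (cM (@cX i z) (@cX j z)) (crad Cp1 z0)).
Qed.

Let cft i : continuous (ft i).
Proof.
apply: (cont_of (ft0 i) (vrM (vanish_norm Yt))) => [x s|z z0]; first exact: bX.
exact: cM (@cX i z) (crad Cq0 z0).
Qed.

Let cf2 i j k : continuous (f2 i j k).
Proof.
apply: (cont_of (f20 i j k) (vanishD (vanishZ 3 (vanish_norm vp1)) (vanish_norm vp2))) => [x s|z z0].
  exact: bf2.
have hX l := @cX l z.
exact: cD (cM (@cC (i == j)%:R z) (cM (hX k) (crad Cp1 z0)))
  (cD (cM (cM (hX i) (hX j)) (cM (hX k) (crad Cp2 z0)))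
    (cM (crad Cp1 z0) (cD (cM (hX i) (@cC (j == k)%:R z)) (cM (hX j) (@cC (i == k)%:R z))))).
Qed.

Let cf1t i j : continuous (f1t i j).
Proof.
apply: (cont_of (f1t0 i j) (vanishD (vanish_norm Yt) (vanish_norm vq1))) => [x s|z z0].
  exact: bq.
exact: cD (cM (@cC (i == j)%:R z) (crad Cq0 z0)) (cM (cM (@cX i z) (@cX j z)) (crad Cq1 z0)).
Qed.

Let cft1 i j : continuous (ft1 i j).
Proof.
apply: (cont_of (ft10 i j) (vanishD (vanish_norm Yt) (vanish_norm vs1))) => [x s|z z0].
  exact: bq.
exact: cD (cM (@cC (i == j)%:R z) (crad Cq0 z0)) (cM (cM (@cX i z) (@cX j z)) (crad Cs1 z0)).
Qed.

Let cftt i : continuous (ftt i).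
Proof.
apply: (cont_of (ftt0 i) (vanish_norm vw0)) => [x s|z z0].
  by rewrite -enormM; exact: bX.
exact: cM (@cX i z) (crad Cw0 z0).
Qed.

Let dM (f g : V -> R) (z v : V) (a b : R) : is_derive z v f a -> is_derive z v g b ->
  is_derive z v (fun z => f z * g z) (f z * b + g z * a).
Proof. exact: is_deriveM. Qed.
Let dD (f g : V -> R) (z v : V) (a b : R) : is_derive z v f a -> is_derive z v g b ->
  is_derive z v (fun z => f z + g z) (a + b).
Proof. exact: is_deriveD. Qed.
Let dC (a : R) (z v : V) : is_derive z v (fun _ : V => a) (0 : R).
Proof. exact: is_derive_cst. Qed.

(* On the line [x = 0] every component vanishes, so time derivatives vanish there. *)
Let deriv_t0 (F : V -> R) (t : R) : (forall s, F (0, s) = 0) -> is_derive ((0 : 'rV[R]_3), t) (0, 1) F 0.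
Proof.
move=> F0; apply/is_derive_line.
rewrite (_ : (fun h => _) = cst 0); first exact: is_derive_cst.
by apply/funext => h; rewrite lineEt F0.
Qed.

(** Off the origin this is the product rule; at the origin the component is [o(|x|)], which matches
    the value 0 of the candidate. *)
Let df0 i k (z : V) : is_derive z (e3 k, 0) (f0 i) (f1 i k z).
Proof.
have [z0|z0] := eqVneq z.1 0.
  case: z z0 => x t /= ->; rewrite f10.
  exact: (vanish_derive k (f00 i t) (vanish_norm vp0) (bX i p0)).
apply: is_derive_eq (dM (dX i k z) (drad k z0 dp0)) _.
by rewrite /f1; ring.
Qed.

Let df0t i (z : V) : is_derive z (0, 1) (f0 i) (ft i z).
Proof.
have [z0|z0] := eqVneq z.1 0.
  by case: z z0 => x t /= ->; rewrite ft0; exact: deriv_t0 (f00 i).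
apply: is_derive_eq (dM (dXt i z) (dradt z0 dp0t)) _.
by rewrite /ft; ring.
Qed.

Let df1 i j k (z : V) : is_derive z (e3 k, 0) (f1 i j) (f2 i j k z).
Proof.
have [z0|z0] := eqVneq z.1 0.
  case: z z0 => x t /= ->; rewrite f20.
  exact: (vanish_derive k (f10 i j t) vZ1 (bf1 i j)).
apply: is_derive_eq (dD (dM (dC _ z _) (drad k z0 dp0))
  (dM (dM (dX i k z) (dX j k z)) (drad k z0 dp1))) _.
by rewrite /f2; ring.
Qed.

Let df1t i j (z : V) : is_derive z (0, 1) (f1 i j) (f1t i j z).
Proof.
have [z0|z0] := eqVneq z.1 0.
  by case: z z0 => x t /= ->; rewrite f1t0; exact: deriv_t0 (f10 i j).
apply: is_derive_eq (dD (dM (dC _ z _) (dradt z0 dp0t))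
  (dM (dM (dXt i z) (dXt j z)) (dradt z0 dp1t))) _.
by rewrite /f1t; ring.
Qed.

Let dft i k (z : V) : is_derive z (e3 k, 0) (ft i) (ft1 i k z).
Proof.
have [z0|z0] := eqVneq z.1 0.
  case: z z0 => x t /= ->; rewrite ft10.
  exact: (vanish_derive k (ft0 i t) (vanish_norm Yt) (bX i q0)).
apply: is_derive_eq (dM (dX i k z) (drad k z0 dq0)) _.
by rewrite /ft1; ring.
Qed.

Let dftt i (z : V) : is_derive z (0, 1) (ft i) (ftt i z).
Proof.
have [z0|z0] := eqVneq z.1 0.
  by case: z z0 => x t /= ->; rewrite ftt0; exact: deriv_t0 (ft0 i).
apply: is_derive_eq (dM (dXt i z) (dradt z0 dq0t)) _.
by rewrite /ftt; ring.
Qed.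

Definition radial_field (z : V) : 'rV[R]_3 := (Y (enorm z.1) z.2 / enorm z.1) *: z.1.

Let U_coord c : (fun z => radial_field z 0 c) = f0 c.
Proof. by apply/funext => z; rewrite !mxE mulrC. Qed.

Let g1 c (j : 'I_4) := if (j < 3)%N then f1 c (inord j) else ft c.
Let g2 c (j i : 'I_4) :=
  if (j < 3)%N then if (i < 3)%N then f2 c (inord j) (inord i) else f1t c (inord j)
  else if (i < 3)%N then ft1 c (inord i) else ftt c.

Let U_C2 : [/\ C2 st_dir radial_field,
  forall j, 'D_(st_dir j) radial_field = fun z => \row_c g1 c j z &
  forall j i, 'D_(st_dir i) ('D_(st_dir j) radial_field) = fun z => \row_c g2 c j i z].
Proof.
apply: C2_rows.
- by move=> c; rewrite U_coord; exact: cf0.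
- by move=> c j; rewrite /g1; case: ifP => _; [exact: cf1|exact: cft].
- move=> c j i; rewrite /g2; case: ifP => _; case: ifP => _.
  + exact: cf2.
  + exact: cf1t.
  + exact: cft1.
  + exact: cftt.
- move=> c j z; rewrite U_coord /g1 /st_dir; case: ifP => _.
  + exact: df0.
  + exact: df0t.
- move=> c j i z; rewrite /g1 /g2 /st_dir; case: (j < 3)%N; case: (i < 3)%N.
  + exact: df1.
  + exact: df1t.
  + exact: dft.
  + exact: dftt.
Qed.

Lemma C2_radial_field : C2 st_dir radial_field.
Proof. by case: U_C2. Qed.

Lemma radial_field_tt x t : 'D_dt ('D_dt radial_field) (x, t) =
  (pd2 (pd2 Y) (enorm x) t / enorm x) *: x.
Proof.
have [_ _ /(_ ord_max ord_max)] := U_C2; rewrite -[st_dir ord_max]/dt.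
move=> /(congr1 (fun f => f (x, t))) ->.
by apply/rowP => c; rewrite !mxE /g2 /= /ftt /X /rad /w0 /= mulrC.
Qed.

Let pdx_U t i j x : pdx j (fun y => radial_field (y, t) 0 i) x = f1 i j (x, t).
Proof.
suff h : is_derive x (e3 j) (fun y => radial_field (y, t) 0 i) (f1 i j (x, t)).
  exact: (@derive_val _ _ _ _ _ _ _ h).
apply/is_derive_line.
have /is_derive_line := df0 i j (x, t); rewrite -U_coord.
rewrite (_ : (fun h => radial_field (h *: (e3 j, (0 : R)) + (x, t)) 0 i) =
  (fun h : R => radial_field (h *: e3 j + x, t) 0 i)) //.
by apply/funext => h; rewrite lineE.
Qed.

(* [d_j U_i = delta_ij p0 + x_i x_j p1] is symmetric, so the field is curl-free. *)
Lemma curl_radial_field t x : curl (fun y => radial_field (y, t)) x = 0.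
Proof.
have f1C i j z : f1 i j z = f1 j i z by rewrite /f1 eq_sym [X i z * _]mulrC.
by apply/rowP => i; rewrite mxE; cbv zeta; rewrite !pdx_U f1C subrr mxE.
Qed.

Lemma curl_curl_radial_field t x : curl (curl (fun y => radial_field (y, t))) x = 0.
Proof.
have -> : curl (fun y => radial_field (y, t)) = fun=> 0.
  by apply/funext => y; exact: curl_radial_field.
by apply/rowP => i; rewrite mxE; cbv zeta; rewrite /pdx !derive_cst subrr mxE.
Qed.

End RadialField.

(** * Modulation by the amplitude *)

Section Product.
Context {R : realType} (g : R -> R) (H : R -> R -> R).
Let G (r _ : R) := g r.
Hypotheses (Cg : Ck 2 right_half G) (CH : Ck 2 setT H)
  (g0 : vanish G) (g1 : vanish (pd1 G)) (g2 : vanish (pd1 (pd1 G))).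

Let oD : open (@right_half R) := @open_right_half R.
Let D0 (r t : R) : 0 < r -> right_half (r, t). Proof. by []. Qed.

(** A rule of L'Hopital type: if [f] tends to 0 and [f' = o(r^n)], then [f = o(r^(n+1))]. *)
Lemma vanish_primitive (f f' : R -> R) n :
  (forall r : R, 0 < r -> is_derive r 1 f (f' r)) -> vanish (fun r _ => f r) ->
  vanish (fun r _ => f' r / r ^+ n) -> vanish (fun r _ => f r / r ^+ n.+1).
Proof.
move=> df /vanish_eps f0 /vanish_eps f'0; apply/vanish_eps => t e e0.
have e20 : 0 < e / 2 by rewrite divr_gt0.
have [d d0 hd] := f'0 t _ e20; exists d => // r _ /andP[r0 rd] _.
have rn : 0 < r ^+ n.+1 by rewrite exprn_gt0.
have er : 0 < e / 2 * r ^+ n.+1 by rewrite mulr_gt0.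
have [d1 d10 hd1] := f0 t _ er.
(* Nothing is known of [f] at 0 itself, so the mean value theorem is applied on [[a, r]], with [a]
   so small that [f a] costs at most half of the allowed error. *)
pose a := Num.min (r / 2) (d1 / 2).
have a0 : 0 < a by rewrite lt_min !divr_gt0.
have ar : a <= r by rewrite ge_min; apply/orP; left; lra.
have ad1 : a < d1 by rewrite gt_min; apply/orP; right; lra.
have hfa := hd1 a t; rewrite a0 ad1 subrr normr0 in hfa.
have {}hfa := hfa isT d10.
have [c /andP[ac cr] E] := mvt_right ar (fun z hz => df z (lt_le_trans a0 (proj1 (andP hz)))).
have c0 : 0 < c by rewrite (lt_le_trans a0).
have hc := hd c t; rewrite c0 (le_lt_trans cr rd) subrr normr0 in hc.
have {}hc := hc isT d0.
rewrite normrM normfV (gtr0_norm (exprn_gt0 n c0)) ltr_pdivrMr ?exprn_gt0 // in hc.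
rewrite normrM normfV (gtr0_norm rn) ltr_pdivrMr // -(subrK (f a) (f r)) E.
rewrite (le_lt_trans (ler_normD _ _)) // [ltRHS](_ : _ = e / 2 * r ^+ n.+1 + e / 2 * r ^+ n.+1); last by lra.
rewrite ler_ltD // normrM exprSr mulrA; apply: ler_pM => //.
  by rewrite (le_trans (ltW hc)) // ler_pM2l // lerXn2r // nnegrE ltW.
by rewrite ger0_norm ?subr_ge0 // gerBl ltW.
Qed.

Let g' r := pd1 G r 0.
Let dg (r : R) : 0 < r -> is_derive r 1 g (g' r).
Proof. by move=> r0; exact: is_derive_pd1 Cg (D0 0 r0). Qed.
Let dg' (r : R) : 0 < r -> is_derive r 1 g' (pd1 (pd1 G) r 0).
Proof. by move=> r0; exact: is_derive_pd1 (Ck_pd1 Cg) (D0 0 r0). Qed.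

Let vg1 : vanish (fun r _ : R => g' r / r).
Proof.
have v : vanish (fun r _ : R => pd1 (pd1 G) r 0 / r ^+ 0).
  by apply: eq_vanish g2 => r t _; rewrite expr0 divr1.
by apply: eq_vanish (vanish_primitive dg' g1 v) => r t _; rewrite expr1.
Qed.

(** Two integrations of the vanishing second derivative give [g = o(r^2)], the order needed for a
    field that is divided by [r]. *)
Let vg0 : vanish (fun r _ : R => g r / r ^+ 2).
Proof.
have v : vanish (fun r _ : R => g' r / r ^+ 1).
  by apply: eq_vanish vg1 => r t _; rewrite expr1.
exact: vanish_primitive dg g0 v.
Qed.

Let vg0r : vanish (fun r _ : R => g r / r).
Proof.
apply: eq_vanish (vanishM vg0 (Ck_fst 0 openT)) => r t r0.
by field; rewrite gt_eqF.
Qed.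

Definition modulated (r t : R) : R := g r * H r t.
Let Y := modulated.

Lemma Ck2_modulated : Ck 2 right_half Y.
Proof. exact: CkM oD Cg (Ck_sub (@subsetT _ _) CH). Qed.

Let dH1 (r t : R) : is_derive r 1 (H^~ t) (pd1 H r t).
Proof. exact: (is_derive_pd1 CH (I : setT (r, t))). Qed.
Let dH2 (r t : R) : is_derive t 1 (H r) (pd2 H r t).
Proof. exact: (is_derive_pd2 CH (I : setT (r, t))). Qed.
Let dH11 (r t : R) : is_derive r 1 ((pd1 H)^~ t) (pd1 (pd1 H) r t).
Proof. exact: (is_derive_pd1 (Ck_pd1 CH) (I : setT (r, t))). Qed.
Let dH12 (r t : R) : is_derive t 1 (pd1 H r) (pd2 (pd1 H) r t).
Proof. exact: (is_derive_pd2 (Ck_pd1 CH) (I : setT (r, t))). Qed.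
Let dH21 (r t : R) : is_derive r 1 ((pd2 H)^~ t) (pd1 (pd2 H) r t).
Proof. exact: (is_derive_pd1 (Ck_pd2 CH) (I : setT (r, t))). Qed.
Let dH22 (r t : R) : is_derive t 1 (pd2 H r) (pd2 (pd2 H) r t).
Proof. exact: (is_derive_pd2 (Ck_pd2 CH) (I : setT (r, t))). Qed.

Let C0 (f : R -> R -> R) : Ck 2 setT f -> [/\ Ck 0 setT f, Ck 0 setT (pd1 f), Ck 0 setT (pd2 f) &
  [/\ Ck 0 setT (pd1 (pd1 f)), Ck 0 setT (pd2 (pd1 f)), Ck 0 setT (pd1 (pd2 f)) &
      Ck 0 setT (pd2 (pd2 f))]].
Proof.
move=> Cf; split; first exact: Ck_le openT _ Cf.
- exact: CkS openT (Ck_pd1 Cf).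
- exact: CkS openT (Ck_pd2 Cf).
- split; [exact: Ck_pd1 (Ck_pd1 Cf)|exact: Ck_pd2 (Ck_pd1 Cf)|
    exact: Ck_pd1 (Ck_pd2 Cf)|exact: Ck_pd2 (Ck_pd2 Cf)].
Qed.

Let dM (f h : R -> R) (x a b : R) : is_derive x 1 f a -> is_derive x 1 h b ->
  is_derive x 1 (fun x => f x * h x) (f x * b + h x * a).
Proof. exact: is_deriveM. Qed.

Let val (f : R -> R) (x d : R) (df : is_derive x 1 f d) : 'D_1 f x = d :=
  @derive_val _ _ _ _ _ _ _ df.

Let Y1 r t : 0 < r -> pd1 Y r t = g' r * H r t + g r * pd1 H r t.
Proof. by move=> r0; rewrite [LHS](val (dM (dg r0) (dH1 r t))); ring. Qed.

Lemma pd2_modulated r t : pd2 Y r t = g r * pd2 H r t.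
Proof.
rewrite [LHS](val (dM (is_derive_cst (g r) t 1) (dH2 r t))) mulr0 addr0.
by [].
Qed.

Lemma pd22_modulated r t : pd2 (pd2 Y) r t = g r * pd2 (pd2 H) r t.
Proof.
have E : pd2 Y r = (fun t => g r * pd2 H r t).
  by apply/funext => t'; exact: pd2_modulated.
rewrite {1}/pd2 E [LHS](val (dM (is_derive_cst (g r) t 1) (dH22 r t))) mulr0 addr0.
by [].
Qed.

Let near_pos (r : R) (f h : R -> R) : 0 < r -> (forall z, 0 < z -> f z = h z) ->
  {near r, f =1 h}.
Proof. by move=> r0 fh; apply: filterS (lt_nbhsr r0) => z /fh. Qed.

Let Y11 r t : 0 < r ->
  pd1 (pd1 Y) r t = pd1 (pd1 G) r 0 * H r t + (2 * (g' r * pd1 H r t) + g r * pd1 (pd1 H) r t).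
Proof.
move=> r0; rewrite {1}/pd1 (@near_eq_derive _ R R _ _ _ 1 (near_pos r0 (fun z z0 => Y1 t z0))).
have h := is_deriveD (dM (dg' r0) (dH1 r t)) (dM (dg r0) (dH11 r t)).
apply: etrans (val h) _.
move: (g r) (g' r) (pd1 (pd1 G) r 0) (H r t) (pd1 H r t) (pd1 (pd1 H) r t) => *; ring.
Qed.

Let Y12 r t : 0 < r -> pd2 (pd1 Y) r t = g' r * pd2 H r t + g r * pd2 (pd1 H) r t.
Proof.
move=> r0; have E : pd1 Y r = (fun t => g' r * H r t + g r * pd1 H r t).
  by apply/funext => t'; exact: Y1.
rewrite {1}/pd2 E.
have h := is_deriveD (dM (is_derive_cst (g' r) t 1) (dH2 r t)) (dM (is_derive_cst (g r) t 1) (dH12 r t)).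
by apply: etrans (val h) _; rewrite /cst; ring.
Qed.

Let Y21 r t : 0 < r -> pd1 (pd2 Y) r t = g' r * pd2 H r t + g r * pd1 (pd2 H) r t.
Proof.
move=> r0; have E : (pd2 Y)^~ t = (fun r => g r * pd2 H r t).
  by apply/funext => r'; exact: pd2_modulated.
by rewrite {1}/pd1 E [LHS](val (dM (dg r0) (dH21 r t))); ring.
Qed.

Lemma vanish_modulated :
  [/\ vanish (fun r t => Y r t / r ^+ 2), vanish (fun r t => pd1 Y r t / r),
      vanish (pd1 (pd1 Y)), vanish (fun r t => pd2 Y r t / r) &
  [/\ vanish (pd2 (pd1 Y)), vanish (pd1 (pd2 Y)) & vanish (pd2 (pd2 Y))]].
Proof.
have [cH cH1 cH2 [cH11 cH12 cH21 cH22]] := C0 CH.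
split; [| | | |split].
- by apply: eq_vanish (vanishM vg0 cH) => r t r0; rewrite /Y /modulated mulrAC.
- apply: eq_vanish (vanishD (vanishM vg1 cH) (vanishM vg0r cH1)) => r t r0.
  by rewrite Y1 //; ring.
- apply: eq_vanish (vanishD (vanishM g2 cH) (vanishD (vanishZ 2 (vanishM g1 cH1)) (vanishM g0 cH11))) => r t r0.
  by rewrite Y11.
- apply: eq_vanish (vanishM vg0r cH2) => r t r0.
  by rewrite pd2_modulated mulrAC.
- apply: eq_vanish (vanishD (vanishM g1 cH2) (vanishM g0 cH12)) => r t r0.
  by rewrite Y12.
- apply: eq_vanish (vanishD (vanishM g1 cH2) (vanishM g0 cH21)) => r t r0.
  by rewrite Y21.
- apply: eq_vanish (vanishM g0 cH22) => r t r0.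
  by rewrite pd22_modulated.
Qed.

End Product.

(** * Restriction of radial functions to a line through the origin *)

Section Ray.
Context {R : realType}.

Lemma derive_ray (V W : normedModType R) (f : V -> W) (v : V) (r : R) :
  'D_1 (fun r : R => f (r *: v)) r = 'D_v f (r *: v).
Proof.
rewrite /derive; set g1 := fun h => h^-1 *: _; set g2 := fun h => h^-1 *: _.
suff -> : g1 = g2 by [].
by apply/funext => h; rewrite /g1 /g2 /= scalerDl [_ *: 1]mulr1.
Qed.

Lemma is_derive_ray (V W : normedModType R) (f : V -> W) (v : V) (r : R) :
  derivable f (r *: v) v -> is_derive r 1 (fun r : R => f (r *: v)) ('D_v f (r *: v)).
Proof.
move=> df; rewrite -derive_ray; apply: derivableP.
apply/derivable1P; move/derivable1P : df.
by under eq_fun do rewrite -scalerDl -[X in X + r](mulr1); exact.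
Qed.

Let e0 : 'rV[R]_3 := e3 ord0.

(** The ray is prolonged to the full line, negative [r] included, so that [r = 0] is an interior
    point and the orbit data are C^2 across it. *)
Lemma Ck2_ray (f : 'rV[R]_3 -> R) : C2 e3 f -> Ck 2 setT (fun r _ : R => f (r *: e0)).
Proof.
move=> [_ [d1 [_ [d2 c2]]]].
have h1 (r t : R) (_ : setT (r, t)) := is_derive_ray (d1 ord0 (r *: e0)).
apply: (Ck_cst_snd openT h1).
have h2 (r t : R) (_ : setT (r, t)) := is_derive_ray (d2 ord0 ord0 (r *: e0)).
apply: (Ck_cst_snd openT h2).
apply: Ck0_1d => r t _.
apply: (cvg_comp (fun r : R => r *: e0) ('D_(e3 ord0) ('D_(e3 ord0) f))).
  exact: scalel_continuous.
exact: c2.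
Qed.

Lemma ray_neq0 (r : R) : r != 0 -> r *: e0 != 0.
Proof.
by move=> r0; rewrite -enorm_gt0 enormZ_e3 normr_gt0.
Qed.

(** Positive [r] keeps the points of the ray off the origin, as the punctured limit requires. *)
Lemma vanish_ray (f : 'rV[R]_3 -> R) :
  f x @[x --> (dnbhs (0 : 'rV[R]_3))] --> (0 : R) -> vanish (fun r _ => f (r *: e0)).
Proof.
move=> f0 t.
suff h : (fun z : R * R => z.1 *: e0) z @[z --> within right_half (nbhs ((0 : R), t))] -->
    dnbhs (0 : 'rV[R]_3) by exact: (cvg_comp _ _ h f0).
move=> A; rewrite /dnbhs /within /= => nA.
have c : (fun z : R * R => z.1 *: e0) z @[z --> ((0 : R), t)] --> (0 : 'rV[R]_3).
  rewrite -[X in _ --> X](scale0r e0).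
  apply: (cvg_comp (fun z : R * R => z.1) (fun r : R => r *: e0)); first exact: cvg_fst.
  exact: scalel_continuous.
apply: (@filterS _ (nbhs ((0 : R), t)) _ _ _ _ (c _ nA)) => z /= Az z0; apply: Az.
by apply: ray_neq0; rewrite gt_eqF.
Qed.

Lemma radial_ray (f : 'rV[R]_3 -> R) x : radial f -> f x = f (enorm x *: e0).
Proof. by move=> rf; apply: rf; rewrite enormZ_e3 ger0_norm ?enorm_ge0. Qed.

End Ray.

(** * The breather *)

Section TimeShift.
Context {R : realType} (H : R -> R -> R) (al : R -> R).
Hypotheses (CH : Ck 2 setT H) (Cal : Ck 2 setT (fun r _ : R => al r)).

Lemma Ck2_shift : Ck 2 setT (fun r t => H r (t + al r)).
Proof.
exact: (@Ck_comp _ 2 setT setT H _ _ openT openT (fun _ _ _ => I) CH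
  (Ck_fst 2 openT) (CkD openT (Ck_snd 2 openT) Cal)).
Qed.

Lemma derive_translate (f : R -> R) (a t : R) : 'D_1 (fun t => f (t + a)) t = 'D_1 f (t + a).
Proof.
rewrite /derive; set g1 := fun h => h^-1 *: _; set g2 := fun h => h^-1 *: _.
suff -> : g1 = g2 by [].
by apply/funext => h; rewrite /g1 /g2 /= addrA.
Qed.

Lemma pd22_shift r t :
  pd2 (pd2 (fun r t => H r (t + al r))) r t = pd2 (pd2 H) r (t + al r).
Proof.
rewrite {1}/pd2 (_ : pd2 _ r = fun t => pd2 H r (t + al r)).
  exact: derive_translate.
by apply/funext => t'; exact: derive_translate.
Qed.

End TimeShift.

Lemma expR_powRV {R : realType} (a c b : R) : b != 0 ->
  expR (a * b * c) `^ b^-1 = expR (a * c).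
Proof.
move=> b0; rewrite /powR gt_eqF ?expR_gt0 // expRK; congr expR.
by field.
Qed.

Section Breather.
Context {R : realType} (p : R) (s q V : 'rV[R]_3 -> R) (T delta : R).
Hypotheses (p1 : 1 < p)
  (s0 : forall x, 0 < s x) (q0 : forall x, 0 < q x) (V0 : forall x, 0 < V x)
  (rs : radial s) (rq : radial q) (rV : radial V)
  (Cs : C2 e3 s) (Cq : C2 e3 q) (CV : C2 e3 V)
  (TE : T = 2 * pi * Num.sqrt (s 0 / q 0))
  (H1 : forall x, x != 0 -> 2 * pi < T * Num.sqrt (q x / s x)).
Let gap (x : 'rV[R]_3) := `|2 * pi - T * Num.sqrt (q x / s x)| `^ (p - 1)^-1.
Hypotheses
  (H3 : exists M : R, forall x,
     `|2 * pi - T * Num.sqrt (q x / s x)| * expR (delta * (p - 1) * enorm x) <= M)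
  (H4 : exists M : R, forall x, q x / V x <= M).

Let e0 : 'rV[R]_3 := e3 ord0.
Let om (r : R) : R := Num.sqrt (q (r *: e0) / s (r *: e0)).
Let qV (r : R) : R := q (r *: e0) / V (r *: e0).
Let m : R := (p + 1) / 2.

Let m1 : 1 < m. Proof. by have := p1; rewrite /m; lra. Qed.
Let pm : p = 2 * m - 1. Proof. by rewrite /m; field. Qed.
Let p10 : 0 < p - 1. Proof. by rewrite subr_gt0. Qed.
Let qs0 x : 0 < q x / s x. Proof. by rewrite divr_gt0. Qed.
Let om0 r : 0 < om r. Proof. by rewrite sqrtr_gt0. Qed.
Let qV0 r : 0 < qV r. Proof. by rewrite divr_gt0. Qed.

Let Tom r : 2 * pi <= T * om r.
Proof.
have [->|r0] := eqVneq r 0; last by apply: ltW; apply: H1; exact: ray_neq0.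
(* At the origin the choice of [T] gives equality: the linear period, with [eta = 0]. *)
have sq0 : 0 <= s 0 / q 0 by rewrite divr_ge0 // ltW.
rewrite /om scale0r TE -mulrA -sqrtrM //.
by rewrite mulrA divfK ?gt_eqF // divff ?gt_eqF // sqrtr1 mulr1.
Qed.

Let Tom_gt r : 0 < r -> 0 < T * om r - 2 * pi.
Proof. by move=> r0; rewrite subr_gt0; apply: H1; apply: ray_neq0; rewrite gt_eqF. Qed.

Let Com : Ck 2 setT (fun r _ : R => om r).
Proof.
apply: (Ck_sqrt openT (fun r _ _ => qs0 (r *: e0))).
exact: Ck_div openT (fun r _ _ => s0 (r *: e0)) (Ck2_ray Cq) (Ck2_ray Cs).
Qed.

Let CqV : Ck 2 setT (fun r _ : R => qV r).
Proof. exact: Ck_div openT (fun r _ _ => V0 (r *: e0)) (Ck2_ray Cq) (Ck2_ray CV). Qed.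

Let gam (r : R) : R := gap (r *: e0).

Let gamE r : gam r = (T * om r - 2 * pi) `^ (p - 1)^-1.
Proof. by rewrite /gam /gap distrC ger0_norm // subr_ge0 Tom. Qed.

Let gam_powR r : gam r `^ (p - 1) = T * om r - 2 * pi.
Proof. by rewrite gamE -powRrM mulVf ?gt_eqF // powRr1 // subr_ge0 Tom. Qed.

Let gam_ge0 r : 0 <= gam r. Proof. by rewrite gamE powR_ge0. Qed.

Let gam_gt0 r : 0 < r -> 0 < gam r.
Proof. by move=> r0; rewrite gamE powR_gt0 // Tom_gt. Qed.

Let oD : open (@right_half R) := @open_right_half R.

(** Restricted to [r > 0]: at [r = 0] the base of the power is 0. The behaviour there is expressed
    by [vanish]. *)
Let Cgam : Ck 2 right_half (fun r _ : R => gam r).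
Proof.
apply: (@eq_Ck _ _ _ (fun r _ => (T * om r - 2 * pi) `^ (p - 1)^-1)); first exact: oD.
  by move=> r t _; rewrite gamE.
apply: Ck_powR oD (fun r _ r0 => Tom_gt r0) _.
apply: Ck_sub (@subsetT _ _) _.
exact: CkB openT (CkM openT (Ck_cst 2 T openT) Com) (Ck_cst 2 (2 * pi) openT).
Qed.

Let pd1_gam : pd1 (fun r _ : R => gam r) = fun r _ => 'D_e0 gap (r *: e0).
Proof. by apply/funext => r; apply/funext => t; exact: derive_ray. Qed.

Let pd11_gam : pd1 (pd1 (fun r _ : R => gam r)) = fun r _ => 'D_e0 ('D_e0 gap) (r *: e0).
Proof.
by apply/funext => r; apply/funext => t; rewrite pd1_gam; exact: (derive_ray ('D_e0 gap)).
Qed.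

Let w : R -> R -> R := wave qV m1 Tom p.
Let Cw : Ck 2 setT w := Ck2_wave m1 qV0 Tom Com CqV p.

Let profile (al : R -> R) : R -> R -> R := modulated gam (fun r t => w r (t + al r)).

(** The linear terms cancel by [om^2 = q / s]. The nonlinear ones agree because
    [gam^(p-1) = T om - 2 pi]: both equal [V gam^(p-1) |wr|^(p-1)] times the radial coefficient. *)
Let ode_cancel x (wr : R) (r := enorm x) : x != 0 ->
  s x * (gam r * (om r ^+ 2 * ((T * om r - 2 * pi) / qV r * (`|wr| `^ (p - 1) * wr) - wr)) / r) +
  q x * (gam r * wr / r) - (V x * `|gam r * wr| `^ (p - 1)) * (gam r * wr / r) = 0.
Proof.
rewrite -enorm_gt0 -/r => r0; rewrite normrM (ger0_norm (gam_ge0 r)).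
rewrite (powRM _ (gam_ge0 r) (normr_ge0 wr)) gam_powR.
rewrite (radial_ray x rs) (radial_ray x rq) (radial_ray x rV) -/r -/e0.
rewrite (sqr_sqrtr (ltW (qs0 (r *: e0)))).
rewrite /qV; move: (gam r) (T * om r - 2 * pi) (`|wr| `^ (p - 1)) => c l z.
have := s0 (r *: e0); have := q0 (r *: e0); have := V0 (r *: e0).
move: (s _) (q _) (V _) => s' q' V' V'0 q'0 s'0.
by field; rewrite !gt_eqF.
Qed.

(** [gam exp (delta r)] is the [(p-1)]-th root of the quantity bounded by [H3], and [H4] bounds the
    wave. The bound holds for all times at once, hence also for shifted waves. *)
Let profile_bound : exists M : R, 0 <= M /\ forall r t, 0 < r ->
  `|gam r * w r t| * expR (delta * r) <= M.
Proof.
have [M1 hM1] := H3; have [M2 hM2] := H4.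
exists (M1 `^ (p - 1)^-1 * (M2 / (pi / m)) `^ (p - 1)^-1).
split; first by rewrite mulr_ge0 ?powR_ge0.
have M10 : 0 <= M1 by rewrite (le_trans _ (hM1 0)) // mulr_ge0 ?expR_ge0.
move=> r t r0; rewrite normrM (ger0_norm (gam_ge0 r)) mulrAC.
have wle : `|w r t| <= (M2 / (pi / m)) `^ (p - 1)^-1.
  apply: le_trans (wave_le m1 qV0 Tom p _ _) _.
  exact: (ampl_le m1 qV0 Tom pm (hM2 (r *: e0))).
have ge0 := mulr_ge0 (gam_ge0 r) (expR_ge0 (delta * r)).
apply: (ler_pM ge0 (normr_ge0 _) _ wle); clear wle.
rewrite -(expR_powRV delta r (lt0r_neq0 p10)).
have l0 : 0 <= T * om r - 2 * pi by rewrite subr_ge0 Tom.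
have x0 := expR_ge0 (delta * (p - 1) * r).
rewrite gamE -(powRM _ l0 x0).
have h := hM1 (r *: e0).
rewrite distrC (ger0_norm l0) enormZ_e3 (gtr0_norm r0) in h.
have p10' : 0 <= (p - 1)^-1 by rewrite invr_ge0 ltW.
exact: ge0_ler_powR p10' _ _ (mulr_ge0 l0 x0) M10 h.
Qed.

Hypotheses
  (H20 : gap x @[x --> (dnbhs (0 : 'rV[R]_3))] --> (0 : R))
  (H21 : forall j, 'D_(e3 j) gap x @[x --> (dnbhs (0 : 'rV[R]_3))] --> (0 : R))
  (H22 : forall i j, 'D_(e3 i) ('D_(e3 j) gap) x @[x --> (dnbhs (0 : 'rV[R]_3))] --> (0 : R)).

Section Shifted.
Variables (al : R -> R) (Cal : Ck 2 setT (fun r _ : R => al r)).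

Let CH := Ck2_shift Cw Cal.
Let vanG : vanish (fun r _ => gam r) := vanish_ray H20.
Let vanG1 : vanish (pd1 (fun r _ => gam r)).
Proof. by rewrite pd1_gam; exact: vanish_ray (H21 _). Qed.
Let vanG2 : vanish (pd1 (pd1 (fun r _ => gam r))).
Proof. by rewrite pd11_gam; exact: vanish_ray (H22 _ _). Qed.

Let U := radial_field (profile al).

Let enorm_U x t : enorm (U (x, t)) = if x == 0 then 0 else `|profile al (enorm x) t|.
Proof.
rewrite /U /radial_field /= enormZ; case: eqVneq => [->|x0]; first by rewrite enorm0 mulr0.
have n0 : 0 < enorm x by rewrite enorm_gt0.
move: (enorm x) n0 (profile al _ t) => r r0 y.
by rewrite normrM normfV (gtr0_norm r0) divfK; [|rewrite gt_eqF].
Qed.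

Let profile_ode r t : profile al r t = gam r * w r (t + al r) /\
  pd2 (pd2 (profile al)) r t = gam r * (om r ^+ 2 * ((T * om r - 2 * pi) / qV r *
    (`|w r (t + al r)| `^ (p - 1) * w r (t + al r)) - w r (t + al r))).
Proof.
split; first exact: erefl.
rewrite /profile (pd22_modulated gam CH) pd22_shift.
by rewrite (wave_ode m1 qV0 Tom Com pm).
Qed.

Let U_smooth : [/\ C2 st_dir U,
  forall x t, 'D_dt ('D_dt U) (x, t) = (pd2 (pd2 (profile al)) (enorm x) t / enorm x) *: x &
  forall x t, curl (curl (fun y => U (y, t))) x = 0].
Proof.
have [v0 v1 v2 v3 [v4 v5 v6]] := vanish_modulated Cgam CH vanG vanG1 vanG2.
have CY : Ck 2 right_half (profile al) := Ck2_modulated Cgam CH.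
split.
- exact: (C2_radial_field CY v0 v1 v2 v3 v4 v5 v6).
- exact: (radial_field_tt CY v0 v1 v2 v3 v4 v5 v6).
- by move=> x t; exact: (curl_curl_radial_field CY v0).
Qed.

Lemma shifted_breather : periodic_breather s q V p T delta U.
Proof.
have [C2U U_tt curlU] := U_smooth; move: CH vanG vanG1 vanG2 => _ _ _ _.
split; first exact: C2U.
split; [|split].
- move=> x t; rewrite /curlcurl_lhs U_tt curlU addr0 enorm_U.
  rewrite /U /radial_field /=.
  (* At the origin every remaining term is a multiple of the vector [x = 0]. *)
  case: eqVneq => [->|x0]; first by rewrite !scaler0 !addr0 subrr.
  rewrite !scalerA -scalerDl -scalerBl.
  apply/eqP; rewrite scaler_eq0; apply/orP; left; apply/eqP.
  have [-> ->] := profile_ode (enorm x) t; exact: ode_cancel.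
- move=> x t; rewrite /U /radial_field /profile /modulated /= addrAC.
  congr ((_ * _ / _) *: _); exact: waveDT.
- have [M hM] := profile_bound; exists M => x t.
  have [M0 hMr] := hM; rewrite enorm_U; case: eqVneq => [_|x0]; first by rewrite mul0r.
  have [-> _] := profile_ode (enorm x) t; apply: hMr; first by rewrite enorm_gt0.
Qed.

End Shifted.

(** On each sphere the equation is autonomous in time, so a radial shift gives a field of the same
    construction with [al r = a (r *: e0)]; the breather itself is the case [al = 0]. *)
Lemma breather_exists : exists U : 'rV[R]_3 * R -> 'rV[R]_3,
    periodic_breather s q V p T delta U /\
    (exists x t, U (x, t) != 0) /\
    (forall a : 'rV[R]_3 -> R, radial a -> C2 e3 a ->
       periodic_breather s q V p T delta (fun xt => U (xt.1, xt.2 + a xt.1))).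
Proof.
exists (radial_field (profile (fun=> 0))); split; [|split].
- exact: shifted_breather (Ck_cst 2 0 openT).
(* Every positive radius has a nonzero factor [gam]; at radius 1 the division by the norm
   disappears. *)
- have [t ht] := wave_neq0 m1 om0 qV0 Tom p 1.
  have n1 : enorm e0 = 1 by rewrite -[e0]scale1r enormZ_e3 normr1.
  exists e0, t; rewrite -enorm_gt0 /radial_field /= enormZ n1 mulr1 divr1 normr_gt0.
  rewrite /profile /modulated addr0.
  exact: mulf_neq0 (lt0r_neq0 (gam_gt0 ltr01)) ht.
- move=> a ra Ca.
  have -> : (fun xt : 'rV[R]_3 * R => radial_field (profile (fun=> 0)) (xt.1, xt.2 + a xt.1)) =
      radial_field (profile (fun r => a (r *: e0))).
    apply/funext => -[x t]; rewrite /radial_field /profile /modulated [LHS]/= addr0.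
    by rewrite (radial_ray x ra).
  exact: shifted_breather (Ck2_ray Ca).
Qed.

End Breather.

Theorem theorem1p2 (R : realType) (p : R) (s q V : 'rV[R]_3 -> R) (T delta : R) :
  1 < p ->
  (forall x, 0 < s x) -> (forall x, 0 < q x) -> (forall x, 0 < V x) ->
  radial s -> radial q -> radial V ->
  C2 e3 s -> C2 e3 q -> C2 e3 V ->
  T = 2 * pi * Num.sqrt (s 0 / q 0) ->
  (* (H1)' *)
  (forall x, x != 0 -> 2 * pi < T * Num.sqrt (q x / s x)) ->
  (* (H2): g := |2 pi - T sqrt(q/s)|^(1/(p-1)) -> 0 in the C^2 sense as x -> 0 *)
  (let g := fun x => `|2 * pi - T * Num.sqrt (q x / s x)| `^ (p - 1)^-1 in
     g x @[x --> (dnbhs (0 : 'rV[R]_3))] --> (0 : R) /\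
     (forall j, 'D_(e3 j) g x @[x --> (dnbhs (0 : 'rV[R]_3))] --> (0 : R)) /\
     (forall i j, 'D_(e3 i) ('D_(e3 j) g) x @[x --> (dnbhs (0 : 'rV[R]_3))] --> (0 : R))) ->
  (* (H3) *)
  0 < delta ->
  (exists M : R, forall x,
     `|2 * pi - T * Num.sqrt (q x / s x)| * expR (delta * (p - 1) * enorm x) <= M) ->
  (* (H4) *)
  (exists M : R, forall x, q x / V x <= M) ->
  exists U : 'rV[R]_3 * R -> 'rV[R]_3,
    periodic_breather s q V p T delta U /\
    (exists x t, U (x, t) != 0) /\
    (forall a : 'rV[R]_3 -> R, radial a -> C2 e3 a ->
       periodic_breather s q V p T delta (fun xt => U (xt.1, xt.2 + a xt.1))).
Proof.
move=> p1 s0 q0 V0 rs rq rV Cs Cq CV TE H1 [H20 [H21 H22]] _ H3 H4.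
exact: (breather_exists p1 s0 q0 V0 rs rq rV Cs Cq CV TE H1 H3 H4 H20 H21 H22).
Qed.
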